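(* Let $G\subset\mathbb{R}^2$ be a finite set of $n$ points (guards) and let $0<\Theta<\pi$. Let $\mathcal{C}$ be the set of all circular arcs that appear in the (curved) boundary of a set $U_i$, where $i$ ranges over the index set $I$ of all tunnels of $G$ for the angle $\Theta$ (see context). Then the set $\mathcal{C}$, which defines the boundary of the $\Theta$-region of $G$ (in the sense that this boundary is contained in the union of the arcs in $\mathcal{C}$), is of size $O\!\left(\frac{n}{\Theta}\right)$; that is, there is an absolute constant $K$, independent of $n$, $\Theta$ and $G$, with $|\mathcal{C}|\le K\frac{n}{\Theta}$.
   Context: A $\Theta$-cone is a planar cone (region between two rays from a common apex) with apex angle $\Theta$; cones are considered as open sets. A $\Theta$-cone is empty (with respect to $G$) if it contains no point of $G$. A point $p\in\mathbb{R}^2$ is $\Theta$-guarded if every $\Theta$-cone with apex $p$ is non-empty. The $\Theta$-region is the set of all $\Theta$-guarded points. The left and right ray of a cone are understood as viewed from its apex into the cone. Circular segments: for $l,r\in G$, $l\neq r$, $C_{l,r}^\Theta$ is the circular arc from $l$ to $r$ (end points in counterclockwise order) all of whose points $p$ see the segment $lr$ under the inscribed angle $\angle lpr=\Theta$. $D_{l,r}^\Theta$ is the closed circular segment bounded by $C_{l,r}^\Theta$ and the chord $lr$; it is the set of possible apex positions of $\Theta$-cones that pass through the segment $lr$ in the given direction, with $l$ on the left and $r$ on the right. Tunnels: start with any empty $\Theta$-cone $c$ that has at least one guard on each of its two rays. Turn the cone clockwise while pushing it towards the point set, such that it always stays empty and always touches a guard on each of its rays, until its apex reaches the position of a guard $l_0$.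 Then start again with $c$ in the original position and rotate it in the same way counterclockwise until its apex reaches the position of another guard $r_0$. Let $L_i$ (resp. $R_i$) be the set of guards that are incident to the left (resp. right) ray of the cone at some moment of this construction, and let $E_i\subseteq L_i\times R_i$ be the set of pairs $(l,r)$ that are simultaneously incident to the (left, right) rays of the rotating cone at some moment. The tunnel $T_i$ is the closure of the union of all cones used during the construction; $I$ indexes all tunnels. Let $h_i$ be the closed half plane bounded by the line through $l_0$ and $r_0$ that contains the sequence of circular arcs drawn by the apex of the rotating cone between $l_0$ and $r_0$. Define $U_i:=\bigcap_{(l,r)\in E_i} D_{l,r}^\Theta\cap h_i$. Its curved boundary is the sequence of circular arcs drawn by the apex. *)

(* Defs.v *)
From HB Require Import structures.
From mathcomp Require Import all_boot all_order all_algebra finmap.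
From mathcomp Require Import all_classical all_reals all_analysis.

Set Implicit Arguments.
Unset Strict Implicit.
Unset Printing Implicit Defensive.

Import Order.TTheory GRing.Theory Num.Theory.
Import numFieldNormedType.Exports.
Local Open Scope classical_set_scope.
Local Open Scope ring_scope.

Section Plane.
Context {R : realType}.
Implicit Types (p q l r : R * R) (phi Theta : R).

Definition dir phi : R * R := (cos phi, sin phi).

Definition cross p q : R := p.1 * q.2 - p.2 * q.1.

(* The norm that the library puts on R * R is the sup norm, so Euclidean
   distances are written out; the induced topology is the usual one. *)
Definition sqdist p q : R := (p.1 - q.1) ^+ 2 + (p.2 - q.2) ^+ 2.

Definition frontier (A : set (R * R)) : set (R * R) := closure A `\` interior A.

Definition left_halfplane p q : set (R * R) :=
  [set x | 0 <= cross (q - p) (x - p)].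

(* Rays are closed: they contain their apex. *)
Definition ray p phi : set (R * R) :=
  [set q | exists2 t : R, 0 <= t & q = p + t *: dir phi].

(* The open Theta-cone with apex p between the rays of directions phi and
   phi + Theta.  Viewed from the apex into the cone, the ray of direction phi is
   the right ray and the ray of direction phi + Theta is the left ray. *)
Definition cone Theta p phi : set (R * R) :=
  [set q | exists t psi : R,
     [/\ 0 < t, phi < psi < phi + Theta & q = p + t *: dir psi]].

Definition left_ray Theta p phi : set (R * R) := ray p (phi + Theta).
Definition right_ray p phi : set (R * R) := ray p phi.

(* The arc C_{l,r}^Theta, for l != r.  Since rays are closed, the end points l
   and r belong to it. *)
Definition inscribed_arc Theta l r : set (R * R) :=
  [set p | exists phi : R, left_ray Theta p phi l /\ right_ray p phi r].

(* The segment D_{l,r}^Theta, for l != r: the closed disc bounded by the circle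
   of C_{l,r}^Theta, cut by the chord lr.  The disc has radius
   |r - l| / (2 sin Theta), and its centre is obtained from the midpoint of the
   chord by moving (|r - l| / 2) * cot Theta to the right of the line directed
   from l to r, the side on which the apices lie. *)
Definition circle_center Theta l r : R * R :=
  2^-1 *: (l + r)
  - (cos Theta / (2 * sin Theta)) *: (- (r - l).2, (r - l).1).

Definition circular_segment Theta l r : set (R * R) :=
  [set p | sqdist p (circle_center Theta l r)
             <= sqdist l r / (2 * sin Theta) ^+ 2]
  `&` left_halfplane r l.

End Plane.

Section Guards.
Context {R : realType}.
Variables (G : {fset R * R}) (Theta : R).
Implicit Types (p l r : R * R) (phi : R).

Definition empty_cone p phi : Prop :=
  forall g, g \in G -> ~ cone Theta p phi g.

Definition guarded p : Prop := forall phi, ~ empty_cone p phi.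

Definition theta_region : set (R * R) := [set p | guarded p].

(* The motion of a rotating cone.  A cone that keeps touching guards on both rays
   can only move while turning, so the motion is parametrized by the direction
   phi of the right ray: it ranges over [sw_lo, sw_hi], and the cone has apex
   sw_apex phi.  Angles are counterclockwise, so the clockwise end is sw_lo. *)
Record sweep := Sweep { sw_lo : R; sw_hi : R; sw_apex : R -> R * R }.

Implicit Type S : sweep.

Definition sw_l0 S : R * R := sw_apex S (sw_lo S).
Definition sw_r0 S : R * R := sw_apex S (sw_hi S).

Definition incident S phi l r : Prop :=
  [/\ l \in G, r \in G, left_ray Theta (sw_apex S phi) phi l
    & right_ray (sw_apex S phi) phi r].

(* The complete motion made of the clockwise turn of the initial cone, until its
   apex first reaches a guard l_0, and of its counterclockwise turn, until its
   apex first reaches another guard r_0.  The initial cone is any cone of the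
   motion. *)
Definition is_tunnel S : Prop :=
  [/\ sw_lo S < sw_hi S,
      {within `[sw_lo S, sw_hi S], continuous (sw_apex S)},
      forall phi, sw_lo S <= phi <= sw_hi S ->
        empty_cone (sw_apex S phi) phi /\ exists l r, incident S phi l r,
      forall phi, sw_lo S < phi < sw_hi S -> sw_apex S phi \notin G
    & [/\ sw_l0 S \in G, sw_r0 S \in G & sw_l0 S != sw_r0 S]].

(* At the two final moments the apex is itself a guard and lies on both rays,
   which would produce pairs that bound no segment traversed by the cone (such as
   pairs with l = r); only the moments before are taken. *)
Definition tunnel_pairs S : set ((R * R) * (R * R)) :=
  [set lr | exists2 phi, sw_lo S < phi < sw_hi S & incident S phi lr.1 lr.2].

Definition sweep_path S : set (R * R) :=
  sw_apex S @` [set phi | sw_lo S <= phi <= sw_hi S].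

Definition tunnel_halfplane S (h : set (R * R)) : Prop :=
  (h = left_halfplane (sw_l0 S) (sw_r0 S) \/
   h = left_halfplane (sw_r0 S) (sw_l0 S)) /\ sweep_path S `<=` h.

Definition tunnel_set S (h : set (R * R)) : set (R * R) :=
  (\bigcap_(lr in tunnel_pairs S) circular_segment Theta lr.1 lr.2) `&` h.

(* One arc of the sequence of arcs drawn by the apex: the part drawn during a
   maximal nondegenerate interval of moments at which the same two guards l and
   r are on the left and right rays. *)
Definition drawn_arc S (A : set (R * R)) : Prop :=
  exists l r (s t : R),
    [/\ sw_lo S <= s, s < t, t <= sw_hi S,
        (forall phi, s <= phi <= t -> incident S phi l r)
      & [/\ forall s' t', sw_lo S <= s' <= s -> t <= t' <= sw_hi S ->
              (forall phi, s' <= phi <= t' -> incident S phi l r) ->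
              s' = s /\ t' = t,
            A = sw_apex S @` [set phi | s <= phi <= t]
          & A `<=` inscribed_arc Theta l r]].

(* Arcs are compared as point sets, so an arc shared by several sweeps (such as a
   sweep and its translate by 2 pi) counts once. *)
Definition boundary_arcs : set (set (R * R)) :=
  [set A | exists S h, [/\ is_tunnel S, tunnel_halfplane S h, drawn_arc S A
                         & A `<=` frontier (tunnel_set S h)]].

End Guards.

(* Main.v *)
Require Import Defs.
From HB Require Import structures.
From mathcomp Require Import all_boot all_order all_algebra finmap.
From mathcomp Require Import all_classical all_reals all_analysis.
From mathcomp Require Import ring lra.

(** The cone is parametrized by the direction of its right ray, and membership in
    it is a pair of sign conditions on cross products.  While the two touched
    guards stay the same, the apex runs on an inscribed arc; turning
    counterclockwise, the left guard can only be replaced by one further out on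
    the left ray and the right guard by one nearer to the apex.  Hence the
    displacements between the successive left (right) guards lie in the angular
    sector swept by the left (right) ray.  This forces the turn to end at a guard,
    after at most [pi - Theta], and it places the whole path of the apex in every
    segment D of the tunnel; strict convexity of the discs keeps the path on one
    side of the chord between its ends.  Clockwise motion is the mirror image.

    A frontier point of the region is unguarded but a limit of guarded points.
    So it is the apex of an empty cone which touches guards on both rays or, if it
    is itself a guard, can start to turn from there.

    For the count, an arc is charged to a guard which, when the arc starts, sees an
    empty cone with another guard on one of its rays.  For a given guard the
    directions of such cones are [Theta]-separated, and guard and direction
    determine the apex, hence the rest of the motion and the arc. *)

Set Implicit Arguments.
Unset Strict Implicit.
Unset Printing Implicit Defensive.

Import Order.TTheory GRing.Theory Num.Theory.
Import numFieldNormedType.Exports.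
Local Open Scope classical_set_scope.
Local Open Scope ring_scope.

(** * Planar vectors and cones *)

Section Vectors.
Context {R : realType}.
Implicit Types (p q u v w l r g : R * R) (a b c t x y phi Theta : R).

(** Two obstacles shape the argument. At the two ends of a motion the apex is itself a guard and
    lies on both of its rays, so that touching says little there. Facts about touched guards are
    therefore proved while the apex is off [G], and carried to the ends by continuity or by a pair
    that is touched on a whole interval; a turn starts from a guard only with this guard as left
    pivot. Moreover, the arcs to be counted come from arbitrary sweeps, not from the constructed
    ones, so uniqueness is derived from emptiness and continuity, by playing the guards touched in
    one sweep against the empty cones of the other.

    Termination rests on the form [cross (r - l) (dir (x + Theta))], whose vanishing puts the apex
    on [r]. If it is nonpositive at a moment [B] for the current pair, it is so for every later pair
    as well; hence a guard is met by the moment [B], and a good choice of [B] bounds the whole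
    turn. *)

Lemma pairE u v : u.1 = v.1 -> u.2 = v.2 -> u = v.
Proof. by case: u => ? ?; case: v => ? ? /= -> ->. Qed.

Lemma scaleE t u : t *: u = (t * u.1, t * u.2).
Proof. by case: u. Qed.

Lemma crossDl u v w : cross (u + v) w = cross u w + cross v w.
Proof. by rewrite /cross /=; ring. Qed.

Lemma crossDr u v w : cross u (v + w) = cross u v + cross u w.
Proof. by rewrite /cross /=; ring. Qed.

Lemma crossNl u v : cross (- u) v = - cross u v.
Proof. by rewrite /cross /=; ring. Qed.

Lemma crossNr u v : cross u (- v) = - cross u v.
Proof. by rewrite /cross /=; ring. Qed.

Lemma crossZl t u v : cross (t *: u) v = t * cross u v.
Proof. by rewrite scaleE /cross /=; ring. Qed.

Lemma crossZr t u v : cross u (t *: v) = t * cross u v.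
Proof. by rewrite scaleE /cross /=; ring. Qed.

Lemma crossC u v : cross u v = - cross v u.
Proof. by rewrite /cross; ring. Qed.

Lemma cross0l v : cross 0 v = 0.
Proof. by rewrite /cross /=; ring. Qed.

Lemma cross_dir a b : cross (dir a) (dir b) = sin (b - a).
Proof. by rewrite sinB /cross /dir /=; ring. Qed.

Lemma cross0r u : cross u 0 = 0.
Proof. by rewrite crossC cross0l oppr0. Qed.

Definition crossE := (crossDl, crossDr, crossNl, crossNr, crossZl, crossZr,
                      cross_dir).

Lemma cross_dirxx a : cross (dir a) (dir a) = 0.
Proof. by rewrite cross_dir subrr sin0. Qed.

Lemma dirDpi a : dir (a + pi) = - dir a.
Proof. by apply: pairE; rewrite /dir /= ?cosDpi ?sinDpi. Qed.

Lemma dir_norm a : cos a ^+ 2 + sin a ^+ 2 = 1 :> R.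
Proof. exact: cos2Dsin2. Qed.

(** For [a <= b <= c <= a + pi] all coefficients are nonnegative, which places [dir b] between the
    two outer directions. *)
Lemma dir_combination a b c :
  sin (c - a) *: dir b = sin (c - b) *: dir a + sin (b - a) *: dir c.
Proof. by apply: pairE; rewrite !scaleE /dir /= !sinB; ring. Qed.

(** Cramer's rule in the basis [dir a], [dir b], multiplied by the determinant so that it holds for
    all angles. *)
Lemma frame v a b :
  sin (b - a) *: v = cross v (dir b) *: dir a + cross (dir a) v *: dir b.
Proof. by apply: pairE; rewrite !scaleE /dir /cross /= !sinB; ring. Qed.

Lemma frame_eq0 v a b : sin (b - a) != 0 ->
  cross v (dir a) = 0 -> cross v (dir b) = 0 -> v = 0.
Proof.
move=> s0 va vb; have := frame v a b; rewrite vb crossC va oppr0 !scale0r addr0.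
move=> /eqP; rewrite scaler_eq0 (negbTE s0) /=; exact: eqP.
Qed.

Lemma sin_ge0_pi' x : 0 <= x -> x <= pi -> 0 <= sin x.
Proof. by move=> ? ?; apply: sin_ge0_pi; apply/andP. Qed.

Lemma sin_gt0_pi' x : 0 < x -> x < pi -> 0 < sin x.
Proof. by move=> ? ?; apply: sin_gt0_pi; apply/andP. Qed.

Lemma scale_eq0_dir t a : (t *: dir a == 0 :> R * R) = (t == 0).
Proof.
rewrite scaler_eq0; case: eqP => //= _; apply/negP => /eqP e.
have := dir_norm a; have [-> ->] : cos a = 0 /\ sin a = 0 by case: e.
by rewrite expr0n /= addr0 => /eqP; rewrite eq_sym oner_eq0.
Qed.

Lemma polar0 v : exists t psi, [/\ 0 <= t, 0 <= psi < 2 * pi & v = t *: dir psi].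
Proof.
case: v => x y; pose t := Num.sqrt (x ^+ 2 + y ^+ 2).
have t0 : 0 <= t by exact: sqrtr_ge0.
have tE : t ^+ 2 = x ^+ 2 + y ^+ 2 by rewrite sqr_sqrtr// addr_ge0// sqr_ge0.
have pi0 := pi_gt0 R.
have [t00|tn0] := eqVneq t 0.
  exists 0, 0; split; rewrite ?lexx//=; first by lra.
  move: tE; rewrite t00 expr0n /= => /esym/eqP.
  rewrite paddr_eq0 ?sqr_ge0// !sqrf_eq0 => /andP[/eqP-> /eqP->].
  by rewrite scale0r.
have tp : 0 < t by rewrite lt_def tn0.
have xt : -1 <= x / t <= 1.
  have : x ^+ 2 <= t ^+ 2 by rewrite tE lerDl sqr_ge0.
  rewrite -ler_sqrt ?sqr_ge0// !sqrtr_sqr (ger0_norm t0) ler_norml.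
  by move=> /andP[h1 h2]; rewrite ler_pdivlMr// ler_pdivrMr//; lra.
have [psi0 cpsi] := acos_def xt.
have xE : x = t * cos (acos (x / t)) by rewrite cpsi mulrC divfK.
have spsi : 0 <= sin (acos (x / t)) by apply: sin_ge0_pi.
have y2 : y ^+ 2 = (t * sin (acos (x / t))) ^+ 2.
  rewrite exprMn; have := dir_norm (acos (x/t)) => e.
  have -> : sin (acos (x / t)) ^+ 2 = 1 - cos (acos (x/t)) ^+ 2 by lra.
  by rewrite mulrBr mulr1 -exprMn -xE tE; ring.
have yE : `|y| = t * sin (acos (x / t)).
  by rewrite -[RHS]ger0_norm ?mulr_ge0// -!sqrtr_sqr y2.
have [y0|y0] := lerP 0 y.
  exists t, (acos (x / t)); split => //; first lra.
  by apply: pairE; rewrite scaleE /= // -yE ger0_norm.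
exists t, (2 * pi - acos (x / t)); split => //.
  rewrite ltrBlDr ltrDl subr_ge0; apply/andP; split; first lra.
  rewrite lt_neqAle; case/andP: psi0 => -> _; rewrite andbT eq_sym.
  apply/eqP => a0; move: yE; rewrite a0 sin0 mulr0 => /eqP.
  by rewrite normr_eq0 => /eqP y00; rewrite y00 ltxx in y0.
have -> : 2 * pi - acos (x / t) = - acos (x / t) + pi *+ 2 by rewrite -mulr_natl; ring.
apply: pairE; rewrite scaleE /= ?cosDpi2 ?sinDpi2.
  by rewrite mulr2n addrA cosDpi cosDpi opprK cosN.
rewrite mulr2n addrA sinDpi sinDpi opprK sinN mulrN -yE ltr0_norm//.
by rewrite opprK.
Qed.

Lemma polar v c : exists t psi, [/\ 0 <= t, c <= psi < c + 2 * pi & v = t *: dir psi].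
Proof.
have [t [psi [t0 hpsi]]] :=
  polar0 (v.1 * cos c + v.2 * sin c, v.2 * cos c - v.1 * sin c).
move=> e; exists t, (c + psi); split => //; first by lra.
have e1 := congr1 fst e; have e2 := congr1 snd e; move: e1 e2.
rewrite !scaleE /= => e1 e2; have n := dir_norm c.
apply: pairE => /=; rewrite ?cosD ?sinD.
  transitivity ((t * cos psi) * cos c - (t * sin psi) * sin c); last by ring.
  rewrite -e1 -e2.
  transitivity (v.1 * (cos c ^+ 2 + sin c ^+ 2)); last by ring.
  by rewrite n mulr1.
transitivity ((t * cos psi) * sin c + (t * sin psi) * cos c); last by ring.
rewrite -e1 -e2.
transitivity (v.2 * (cos c ^+ 2 + sin c ^+ 2)); last by ring.
by rewrite n mulr1.
Qed.

Lemma dir_inj_2pi a b : 0 <= b - a < 2 * pi -> dir a = dir b -> a = b.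
Proof.
move=> hab e; have [e1 e2] : cos a = cos b /\ sin a = sin b by case: e.
have c1 : cos (b - a) = 1 by rewrite cosB -e1 -e2 -!expr2 dir_norm.
have [h|h] := lerP (b - a) pi.
  have /cosK e0 : (b - a) \in `[0, pi] by rewrite in_itv /=; lra.
  by move: e0; rewrite c1 acos1; lra.
have := @cosKN R (b - a - 2 * pi).
have -> : cos (b - a - 2 * pi) = 1.
  have : cos (b - a) = cos (b - a - 2 * pi + pi + pi) by congr cos; ring.
  by rewrite !cosDpi opprK => <-.
by rewrite acos1 => k; have := pi_gt0 R => ?; have := k (ltac:(lra)); lra.
Qed.

(** Since [Theta < pi], the cone is an intersection of two open half planes. In this form membership
    is visibly an open condition on apex and direction. *)
Lemma coneP Theta p phi g : 0 < Theta < pi ->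
  cone Theta p phi g <->
  0 < cross (dir phi) (g - p) /\ 0 < cross (g - p) (dir (phi + Theta)).
Proof.
move=> hT; split.
  move=> [t [psi [t0 hpsi ->]]].
  rewrite [p + _]addrC addrK !crossE; split; apply: mulr_gt0 => //;
    apply: sin_gt0_pi'; lra.
have [t [psi [t0 hpsi e]]] := polar (g - p) phi.
rewrite e !crossE => -[h1 h2].
have tp : 0 < t.
  by rewrite lt_def t0 andbT; apply/eqP => z; rewrite z mul0r ltxx in h1.
move: h1 h2; rewrite !pmulr_rgt0// => h1 h2.
have hx : phi < psi.
  rewrite lt_neqAle; case/andP: hpsi => -> _; rewrite andbT.
  by apply/eqP => z; rewrite z subrr sin0 ltxx in h1.
have hy : psi < phi + pi.
  rewrite ltNge; apply/negP => k.
  have : 0 <= sin (psi - phi - pi) by apply: sin_ge0_pi'; lra.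
  by have := sinDpi (psi - phi - pi); rewrite subrK; lra.
exists t, psi; split => //; last by rewrite -e addrC subrK.
rewrite hx /= ltNge; apply/negP => k.
have : 0 <= sin (psi - (phi + Theta)) by apply: sin_ge0_pi'; lra.
by rewrite -opprB sinN; lra.
Qed.

Definition dot u v := u.1 * v.1 + u.2 * v.2.

(** In this form, an equation and a weak inequality between continuous quantities, the condition is
    visibly closed. *)
Lemma rayP p phi g : ray p phi g <->
  cross (dir phi) (g - p) = 0 /\ 0 <= dot (dir phi) (g - p).
Proof.
have n := dir_norm phi.
split.
  move=> [t t0 ->]; rewrite [p + _]addrC addrK !crossE subrr sin0 mulr0; split=> //.
  rewrite /dot scaleE /dir /=.
  have -> : cos phi * (t * cos phi) + sin phi * (t * sin phi) =
            t * (cos phi ^+ 2 + sin phi ^+ 2) by ring.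
  by rewrite n mulr1.
move=> [h1 h2]; exists (dot (dir phi) (g - p)) => //.
apply/eqP; rewrite -subr_eq0 opprD addrA; apply/eqP; move: h1 h2.
case: (g - p) => w1 w2; rewrite /cross /dot scaleE /dir /= => h1 h2.
apply: pairE => /=.
  transitivity (w1 * (1 - (cos phi ^+ 2 + sin phi ^+ 2))
    - sin phi * (cos phi * w2 - sin phi * w1)); first by ring.
  by rewrite h1 n subrr !mulr0 subrr.
transitivity (w2 * (1 - (cos phi ^+ 2 + sin phi ^+ 2))
    + cos phi * (cos phi * w2 - sin phi * w1)); first by ring.
by rewrite h1 n subrr !mulr0 addr0.
Qed.

Lemma continuous_cross_dir v c : continuous (fun phi => cross v (dir (phi + c))).
Proof.
move=> phi; rewrite /cross /dir /=.
have sh : (fun x : R => x + c) @ phi --> phi + c.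
  by apply: cvgD; [exact: cvg_id|exact: cvg_cst].
apply: cvgB; apply: cvgM; try exact: cvg_cst.
  by apply: (cvg_comp _ _ sh); exact: continuous_sin.
by apply: (cvg_comp _ _ sh); exact: continuous_cos.
Qed.

(** For [a < b < a + pi] this is the closed sector between the two directions. Being a convex cone,
    it is closed under addition, so displacements can be accumulated over a motion. *)
Definition between a b v : Prop :=
  exists x y, [/\ 0 <= x, 0 <= y & v = x *: dir a + y *: dir b].

Lemma betweenD a b u v : between a b u -> between a b v -> between a b (u + v).
Proof.
move=> [x [y [x0 y0 ->]]] [x' [y' [x0' y0' ->]]].
exists (x + x'), (y + y'); split; rewrite ?addr_ge0//.
by rewrite !scalerDl addrACA.
Qed.

Lemma between_dir a b c t : a < c -> c - a < pi -> a <= b <= c -> 0 <= t ->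
  between a c (t *: dir b).
Proof.
move=> ac cpi abc t0; have s0 : 0 < sin (c - a) by apply: sin_gt0_pi'; lra.
exists (t * sin (c - b) / sin (c - a)), (t * sin (b - a) / sin (c - a)).
split.
- by apply: divr_ge0; rewrite ?(ltW s0)// mulr_ge0// sin_ge0_pi'//; lra.
- by apply: divr_ge0; rewrite ?(ltW s0)// mulr_ge0// sin_ge0_pi'//; lra.
have -> : t *: dir b = (t / sin (c - a)) *: (sin (c - a) *: dir b).
  by rewrite scalerA divfK// gt_eqF.
rewrite dir_combination scalerDr !scalerA.
by congr (_ *: _ + _ *: _); ring.
Qed.

Lemma between_widen a b a' b' v : a' < b' -> b' - a' < pi ->
  a' <= a <= b' -> a' <= b <= b' -> between a b v -> between a' b' v.
Proof.
move=> h1 h2 h3 h4 [x [y [x0 y0 ->]]].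
by apply: betweenD; apply: between_dir.
Qed.

End Vectors.

(** * One-sided neighborhoods and finite sets of guards *)

Section Nearness.
Context {R : realType}.
Implicit Types (x : R) (P : R -> Prop) (f : R -> R).

Lemma at_rightP x P : (\forall y \near x^'+, P y) <->
  exists2 e, 0 < e & forall y, x < y < x + e -> P y.
Proof.
split.
  move=> /nbhs_ballP[e /= e0 h]; exists e => // y hy; apply: h; last by case/andP: hy.
  by rewrite /ball/= ltr0_norm; lra.
move=> [e e0 h]; apply/nbhs_ballP; exists e => // y /=.
by rewrite /ball/= ltr_norml => hy xy; apply: h; lra.
Qed.

Lemma at_leftP x P : (\forall y \near x^'-, P y) <->
  exists2 e, 0 < e & forall y, x - e < y < x -> P y.
Proof.
split.
  move=> /nbhs_ballP[e /= e0 h]; exists e => // y hy; apply: h; last by case/andP: hy.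
  by rewrite /ball/= gtr0_norm; lra.
move=> [e e0 h]; apply/nbhs_ballP; exists e => // y /=.
by rewrite /ball/= ltr_norml => hy xy; apply: h; lra.
Qed.

Lemma filter_fset (T : Type) (F : set_system T) (I : choiceType) (G : {fset I})
    (P : I -> T -> Prop) : Filter F ->
  (forall g, g \in G -> \forall x \near F, P g x) ->
  \forall x \near F, forall g, g \in G -> P g x.
Proof.
move=> FF h.
have : \forall x \near F, forall i : G, P (val i) x.
  by apply: filter_forall => i; apply: h; exact: valP.
by apply: filterS => x k g gG; exact: (k [` gG]%fset).
Qed.

Lemma near_right_pos f x : continuous f -> 0 < f x -> \forall y \near x^'+, 0 < f y.
Proof. by move=> cf; apply: cvgr_gt; apply: cvg_at_right_filter; exact: cf. Qed.

Lemma near_left_pos f x : continuous f -> 0 < f x -> \forall y \near x^'-, 0 < f y.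
Proof. by move=> cf; apply: cvgr_gt; apply: cvg_at_left_filter; exact: cf. Qed.

Lemma near_right_witness x b P : x < b -> (\forall y \near x^'+, P y) ->
  exists2 y, x < y < b & P y.
Proof.
move=> xb /at_rightP[e e0 h]; exists (Num.min ((x + b) / 2) (x + e / 2)).
  by rewrite lt_min gt_min; lra.
by apply: h; rewrite lt_min gt_min; lra.
Qed.

Lemma near_left_witness x a P : a < x -> (\forall y \near x^'-, P y) ->
  exists2 y, a < y < x & P y.
Proof.
move=> ax /at_leftP[e e0 h]; exists (Num.max ((x + a) / 2) (x - e / 2)).
  by rewrite lt_max gt_max; lra.
by apply: h; rewrite lt_max gt_max; lra.
Qed.

End Nearness.

Lemma fset_argmin (R : realType) (I : choiceType) (G : {fset I}) (P : I -> Prop)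
    (f : I -> R) :
  (exists2 g, g \in G & P g) ->
  exists g, [/\ g \in G, P g & forall h, h \in G -> P h -> f g <= f h].
Proof.
suff H (s : seq I) : (exists2 g, g \in s & P g) ->
    exists g, [/\ g \in s, P g & forall h, h \in s -> P h -> f g <= f h].
  exact: (H (enum_fset G)).
elim: s => [[g]//|a s ih [g0 g0s Pg0]].
have [[g gs Pg]|nex] := pselect (exists2 g, g \in s & P g).
  have [g1 [g1s Pg1 g1min]] : exists g, [/\ g \in s, P g &
    forall h, h \in s -> P h -> f g <= f h] by apply: ih; exists g.
  have [[Pa fa]|na] := pselect (P a /\ f a <= f g1).
    exists a; split; rewrite ?mem_head// => h; rewrite inE => /orP[/eqP->//|hs Ph].
    by apply: le_trans fa _; exact: g1min.
  exists g1; split; rewrite ?inE ?g1s ?orbT// => h.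
  rewrite inE => /orP[/eqP-> Pa|]; last exact: g1min.
  by rewrite leNgt; apply/negP => fg; apply: na; split => //; exact: ltW.
have e : g0 = a.
  by move: g0s; rewrite inE => /orP[/eqP//|g0s]; case: nex; exists g0.
exists a; split; rewrite ?mem_head -?e// => h; rewrite inE => /orP[/eqP->//|hs Ph].
by case: nex; exists h.
Qed.

Lemma fset_card_lt (I : choiceType) (G : {fset I}) (P Q : pred I) g0 :
  (forall g, P g -> Q g) -> g0 \in G -> Q g0 -> ~~ P g0 ->
  (#|` [fset g in G | P g]| < #|` [fset g in G | Q g]|)%fset%N.
Proof.
move=> PQ g0G Qg0 nPg0; apply: fproper_ltn_card; rewrite fproperE; apply/andP; split.
  by apply/fsubsetP => g; rewrite !inE /= => /andP[-> /PQ].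
by apply/negP => /fsubsetP/(_ g0); rewrite !inE /= g0G Qg0 => /(_ isT); exact/negP.
Qed.

(** * Turning about two guards *)

Section Motion.
Context {R : realType}.
Variables (G : {fset R * R}) (Theta : R).
Hypothesis hT : 0 < Theta < pi.
Implicit Types (p q l r g : R * R) (phi x t b : R).

Let sT : 0 < sin Theta. Proof. exact: sin_gt0_pi. Qed.
Let sT0 : sin Theta != 0. Proof. by rewrite gt_eqF. Qed.
Let sTE phi : sin (phi + Theta - phi) = sin Theta.
Proof. by congr sin; ring. Qed.
Let sDT x phi : sin (x + Theta - (phi + Theta)) = sin (x - phi).
Proof. by congr sin; ring. Qed.

Lemma continuous_cross_dir0 (v : R * R) : continuous (fun phi => cross v (dir phi)).
Proof.
by have := @continuous_cross_dir R v 0; under eq_fun do rewrite addr0.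
Qed.

Lemma frameT v phi :
  v = (cross v (dir (phi + Theta)) / sin Theta) *: dir phi
      + (cross (dir phi) v / sin Theta) *: dir (phi + Theta).
Proof.
apply: (scalerI sT0); rewrite scalerDr !scalerA ![sin Theta * _]mulrC !divfK//.
by rewrite -(sTE phi) frame.
Qed.

Definition touch q phi l r : Prop :=
  [/\ l \in G, r \in G, left_ray Theta q phi l & right_ray q phi r].

(** The intersection of the line through [r] of direction [phi] with the line through [l] of
    direction [phi + Theta]. It makes sense for all [phi]; whether [l] and [r] lie ahead of it is a
    matter of two signs. *)
Definition apex l r phi : R * R :=
  r - (cross (r - l) (dir (phi + Theta)) / sin Theta) *: dir phi.

Lemma apexE l r phi :
  apex l r phi = l - (cross (r - l) (dir phi) / sin Theta) *: dir (phi + Theta).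
Proof.
have e := frameT (r - l) phi; move: e; rewrite [cross (dir phi) _]crossC.
move=> e; rewrite /apex; apply/eqP; rewrite subr_eq addrAC -subr_eq opprK -subr_eq.
move: e; rewrite mulNr scaleNr; set A := _ *: dir phi; set B := _ *: dir _ => e.
by rewrite -addrA -[B - A]opprB -e opprB addrC subrK.
Qed.

Lemma cross_apex_r l r phi g :
  cross (dir phi) (g - apex l r phi) = cross (dir phi) (g - r).
Proof. by rewrite /apex opprB !crossE subrr sin0; ring. Qed.

Lemma cross_apex_l l r phi g :
  cross (g - apex l r phi) (dir (phi + Theta)) = cross (g - l) (dir (phi + Theta)).
Proof. by rewrite apexE opprB !crossE subrr sin0; ring. Qed.

Lemma rays_apex q phi l r :
  left_ray Theta q phi l -> right_ray q phi r -> q = apex l r phi.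
Proof.
move=> [t t0 lE] [s s0 rE]; rewrite /apex.
have -> : r - l = s *: dir phi - t *: dir (phi + Theta).
  by rewrite rE lE opprD addrACA subrr add0r.
rewrite !crossE subrr sin0 sTE.
have -> : (s * sin Theta + - (t * 0)) / sin Theta = s.
  by rewrite mulr0 oppr0 addr0 mulfK.
by rewrite rE addrK.
Qed.

Lemma apex_right_ray l r phi : 0 <= cross (r - l) (dir (phi + Theta)) ->
  right_ray (apex l r phi) phi r.
Proof.
move=> h; exists (cross (r - l) (dir (phi + Theta)) / sin Theta).
  by rewrite divr_ge0// ltW.
by rewrite /apex subrK.
Qed.

Lemma apex_left_ray l r phi : 0 <= cross (r - l) (dir phi) ->
  left_ray Theta (apex l r phi) phi l.
Proof.
move=> h; exists (cross (r - l) (dir phi) / sin Theta).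
  by rewrite divr_ge0// ltW.
by rewrite apexE subrK.
Qed.

Lemma apex_eq_r l r phi : cross (r - l) (dir (phi + Theta)) = 0 <-> apex l r phi = r.
Proof.
split=> [h|e]; first by rewrite /apex h mul0r scale0r subr0.
by have := cross_apex_l l r phi r; rewrite e subrr cross0l.
Qed.

Lemma apex_eq_l l r phi : cross (r - l) (dir phi) = 0 <-> apex l r phi = l.
Proof.
split=> [h|e]; first by rewrite apexE h mul0r scale0r subr0.
have := cross_apex_r l r phi l; rewrite e subrr crossC cross0l oppr0 => /esym.
by rewrite crossC -[l - r]opprB crossNl opprK.
Qed.

Lemma point_eq phi u v :
  cross (dir phi) (u - v) = 0 -> cross (u - v) (dir (phi + Theta)) = 0 -> u = v.
Proof.
move=> h1 h2; apply/eqP; rewrite -subr_eq0; apply/eqP.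
apply: (@frame_eq0 _ _ phi (phi + Theta)); rewrite ?sTE//.
by rewrite crossC h1 oppr0.
Qed.

Lemma right_ray_of_cross q phi g : cross (dir phi) (g - q) = 0 ->
  g = q + (cross (g - q) (dir (phi + Theta)) / sin Theta) *: dir phi.
Proof.
move=> h; have := frameT (g - q) phi.
by rewrite h mul0r scale0r addr0 => <-; rewrite addrC subrK.
Qed.

Lemma left_ray_of_cross q phi g : cross (g - q) (dir (phi + Theta)) = 0 ->
  g = q + (cross (dir phi) (g - q) / sin Theta) *: dir (phi + Theta).
Proof.
move=> h; have := frameT (g - q) phi.
by rewrite h mul0r scale0r add0r => <-; rewrite addrC subrK.
Qed.

Lemma empty_coneP p phi : empty_cone G Theta p phi <->
  forall g, g \in G ->
    ~ (0 < cross (dir phi) (g - p) /\ 0 < cross (g - p) (dir (phi + Theta))).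
Proof. by split=> h g gG /(coneP _ _ _ hT)/(h _ gG). Qed.

Lemma empty_apexP l r phi : empty_cone G Theta (apex l r phi) phi <->
  forall g, g \in G ->
    ~ (0 < cross (dir phi) (g - r) /\ 0 < cross (g - l) (dir (phi + Theta))).
Proof.
rewrite empty_coneP; split=> h g gG; have := h g gG;
  by rewrite cross_apex_l cross_apex_r.
Qed.

(** That [l] and [r] lie on the rays, and not behind the apex, is not asked here; along an arc it is
    supplied by [arc_touch]. *)
Definition good l r phi : Prop :=
  empty_cone G Theta (apex l r phi) phi /\ apex l r phi \notin G.

(** The right pivots for a counterclockwise turn: [l] is the farthest guard on the left ray and [r]
    the nearest one on the right ray apart from the apex, since any other choice would let a guard
    enter the cone. The apex may be [l], so that a turn can start at a guard, but not [r]. *)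
Record state phi l r : Prop := State {
  st_l : l \in G;
  st_r : r \in G;
  st_a : 0 < cross (r - l) (dir (phi + Theta));
  st_b : 0 <= cross (r - l) (dir phi);
  st_empty : empty_cone G Theta (apex l r phi) phi;
  st_far : forall g, g \in G -> left_ray Theta (apex l r phi) phi g ->
    exists2 c, 0 <= c & l = g + c *: dir (phi + Theta);
  st_near : forall g, g \in G -> right_ray (apex l r phi) phi g ->
    g <> apex l r phi -> exists2 c, 0 <= c & g = r + c *: dir phi }.

Lemma sin_near_right phi : \forall x \near phi^'+, 0 < sin (x - phi).
Proof.
apply/at_rightP; exists pi; first exact: pi_gt0.
by move=> y hy; apply: sin_gt0_pi'; lra.
Qed.

Lemma sin_near_left phi : \forall x \near phi^'-, 0 < sin (phi - x).
Proof.
apply/at_leftP; exists pi; first exact: pi_gt0.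
by move=> y hy; apply: sin_gt0_pi'; lra.
Qed.

Lemma advance phi l r : state phi l r -> \forall x \near phi^'+, good l r x.
Proof.
move=> [lG rG a0 b0 em far nr].
(* The second conjunct says that [g] is not the apex: the lines of the two rays meet only there. *)
have : \forall x \near phi^'+, forall g, g \in G ->
  ~ (0 < cross (dir x) (g - r) /\ 0 < cross (g - l) (dir (x + Theta))) /\
  ~ (cross (dir x) (g - r) = 0 /\ cross (g - l) (dir (x + Theta)) = 0).
  apply: filter_fset => g gG.
  have cA := @continuous_cross_dir0 (g - r).
  have cB := @continuous_cross_dir R (g - l) Theta.
  have Aneg : 0 < cross (g - r) (dir phi) -> \forall x \near phi^'+,
    cross (dir x) (g - r) < 0.
    move=> h; near=> x; rewrite crossC oppr_lt0; near: x.
    exact: (near_right_pos cA).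
  have Bneg : cross (g - l) (dir (phi + Theta)) < 0 -> \forall x \near phi^'+,
    cross (g - l) (dir (x + Theta)) < 0.
    move=> h; have := cvgr_lt _ (cvg_at_right_filter (cB phi)) 0 h; exact.
  (* The left line always passes through [l], so only this sign keeps the apex off [l]. It holds
     even if the turn starts at [l], since then [r - l] has direction [phi]. *)
  have ll : \forall x \near phi^'+, 0 < cross (dir x) (l - r).
    have eq x : cross (dir x) (l - r) = cross (r - l) (dir x).
      by rewrite crossC -crossNl opprB.
    have [b00|bn0] := eqVneq (cross (r - l) (dir phi)) 0.
      have /apex_eq_l ql := b00.
      have rE : r - l = (cross (r - l) (dir (phi + Theta)) / sin Theta) *: dir phi.
        by rewrite -{1}ql /apex opprB addrC subrK.
      near=> x; rewrite eq rE crossZl cross_dir; apply: mulr_gt0.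
        exact: divr_gt0.
      by near: x; exact: sin_near_right.
    near=> x; rewrite eq; near: x; apply: near_right_pos.
      exact: continuous_cross_dir0.
    by rewrite lt_def bn0.
  have [A0|A0] := ltrP (cross (dir phi) (g - r)) 0.
    have : 0 < cross (g - r) (dir phi) by rewrite crossC oppr_gt0.
    by move=> /Aneg; apply: filterS => x h; split=> -[h1 h2]; lra.
  have [B0|B0] := ltrP (cross (g - l) (dir (phi + Theta))) 0.
    by move: B0 => /Bneg; apply: filterS => x h; split=> -[h1 h2]; lra.
  (* Guards nearer than [l] on the left ray are left outside the cone as soon as this ray turns
     about [l]. *)
  have glcase c : 0 <= c -> l = g + c *: dir (phi + Theta) ->
    \forall x \near phi^'+,
    ~ (0 < cross (dir x) (g - r) /\ 0 < cross (g - l) (dir (x + Theta))) /\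
    ~ (cross (dir x) (g - r) = 0 /\ cross (g - l) (dir (x + Theta)) = 0).
    move=> c0 lE; have glE : g - l = - (c *: dir (phi + Theta)).
      by rewrite lE opprD addrA subrr add0r.
    have [cz|cn] := eqVneq c 0.
      have -> : g = l by rewrite lE cz scale0r addr0.
      near=> x; rewrite subrr cross0l.
      have h : 0 < cross (dir x) (l - r) by near: x.
      by split=> -[h1 h2]; lra.
    near=> x; rewrite glE !crossE sDT.
    have h : 0 < c * sin (x - phi).
      apply: mulr_gt0; first by rewrite lt_def cn.
      by near: x; exact: sin_near_right.
    by split=> -[h1 h2]; lra.
  have [A00|An0] := eqVneq (cross (dir phi) (g - r)) 0.
    have /right_ray_of_cross gE := A00.
    rewrite -(cross_apex_r l) in A00; rewrite -(cross_apex_l l r) in B0.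
    have [B00|Bn0] := eqVneq (cross (g - apex l r phi) (dir (phi + Theta))) 0.
      have gq := point_eq A00 B00.
      have [|c c0 lE] := far _ gG; last exact: (glcase c).
      by exists 0; rewrite // gq scale0r addr0.
    have Bp : 0 < cross (g - apex l r phi) (dir (phi + Theta)) by rewrite lt_def Bn0.
    have /right_ray_of_cross gq := A00.
    have [||c c0 rE] := nr _ gG.
    - exists (cross (g - apex l r phi) (dir (phi + Theta)) / sin Theta) => //.
      by rewrite divr_ge0 // ltW.
    - by move=> gqe; rewrite gqe subrr cross0l ltxx in Bp.
    have [cz|cn] := eqVneq c 0.
      have -> : g = r by rewrite rE cz scale0r addr0.
      near=> x; have h : 0 < cross (r - l) (dir (x + Theta)).
        by near: x; apply: near_right_pos => //; exact: continuous_cross_dir.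
      rewrite subrr [cross (dir x) 0]crossC cross0l.
      by split=> -[h1 h2]; lra.
    have grE : g - r = c *: dir phi by rewrite rE addrC addKr.
    near=> x; rewrite grE !crossE -[phi - x]opprB sinN.
    have h : 0 < c * sin (x - phi).
      apply: mulr_gt0; first by rewrite lt_def cn.
      by near: x; exact: sin_near_right.
    by split=> -[h1 h2]; lra.
  have Ap : 0 < cross (dir phi) (g - r) by rewrite lt_def An0.
  have B00 : cross (g - l) (dir (phi + Theta)) = 0.
    apply/eqP; apply: contrapT => /negP Bn; move/empty_apexP: em => /(_ _ gG); apply.
    by split => //; rewrite lt_def Bn.
  rewrite -(cross_apex_r l) in Ap; rewrite -(cross_apex_l l r) in B00.
  have gq := left_ray_of_cross B00.
  have [|c c0 lE] := far _ gG; last exact: (glcase c).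
  exists (cross (dir phi) (g - apex l r phi) / sin Theta) => //.
  by rewrite divr_ge0// ltW.
apply: filterS => x h; split.
  by apply/empty_apexP => g /h[].
apply/negP => /h [_]; apply; rewrite -(cross_apex_r l) -(cross_apex_l l r).
by rewrite subrr cross0l crossC cross0l oppr0.
Unshelve. all: by end_near.
Qed.

End Motion.

(** * Extending a motion arc by arc *)

Section Extension.
Context {R : realType}.
Variables (G : {fset R * R}) (Theta : R).
Hypothesis hT : 0 < Theta < pi.
Implicit Types (p l r g : R * R) (q : R -> R * R) (phi x t a b B : R).

Ltac tlra := have /andP[? ?] := hT; lra.
Let sT : 0 < sin Theta. Proof. exact: sin_gt0_pi. Qed.

Let sDT x phi : sin (x + Theta - (phi + Theta)) = sin (x - phi).
Proof. by congr sin; ring. Qed.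

Let sTx x : sin (x + Theta - x) = sin Theta. Proof. by congr sin; ring. Qed.

Lemma sub_ray (q u : R * R) s t : (s - t) *: u = (q + s *: u) - (q + t *: u).
Proof. by rewrite scalerBl opprD addrACA subrr add0r. Qed.

Lemma cross_flip (u g r : R * R) : cross u (g - r) = cross (r - g) u.
Proof. by rewrite crossC -crossNl opprB. Qed.

(** With [v = r - l]: on an arc run through counterclockwise, the apex cannot return to [l] before
    it has passed [r]. *)
Lemma left_pivot_pos (v : R * R) phi x :
  0 < cross v (dir (phi + Theta)) -> 0 <= cross v (dir phi) ->
  phi < x <= phi + pi - Theta -> 0 <= cross v (dir (x + Theta)) ->
  0 < cross v (dir x).
Proof.
move=> a0 b0 hx ax; have := frameT hT v phi.
set a := _ / _; set b' := _ / _ => e.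
have ap : 0 < a by exact: divr_gt0.
have bp : b' <= 0.
  by rewrite /b' crossC mulNr oppr_le0; apply: divr_ge0 => //; exact: ltW.
move: ax; rewrite e !crossDl !crossZl !cross_dir sDT.
have -> : x + Theta - phi = (x - phi) + Theta by ring.
have -> : x - (phi + Theta) = (x - phi) - Theta by ring.
set y := x - phi => h.
have sy : 0 < sin y by apply: sin_gt0_pi'; rewrite /y; tlra.
have [sm|sp] := lerP (sin (y - Theta)) 0.
  have : 0 < a * sin y by exact: mulr_gt0.
  have : 0 <= b' * sin (y - Theta) by exact: mulr_le0.
  lra.
(* The goal times [sin y] and the hypothesis times [sin (y - Theta)] have the same term in [b']; by
   this identity they differ by [a * sin Theta ^+ 2], which is positive. *)
have id : sin y * sin y - sin (y + Theta) * sin (y - Theta) = sin Theta ^+ 2.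
  rewrite sinD sinB; have := cos2Dsin2 y; have := cos2Dsin2 Theta.
  move=> e1 e2; have c2 : cos y ^+ 2 = 1 - sin y ^+ 2 by lra.
  have c1 : cos Theta ^+ 2 = 1 - sin Theta ^+ 2 by lra.
  transitivity (sin y ^+ 2 - (sin y ^+ 2 * cos Theta ^+ 2 - cos y ^+ 2 * sin Theta ^+ 2)).
    by ring.
  by rewrite c1 c2; ring.
rewrite -(pmulr_rgt0 _ sy).
have h1 := mulr_ge0 (ltW sp) h.
have h2 : 0 < a * sin Theta ^+ 2 by rewrite mulr_gt0// exprn_gt0.
by rewrite -id in h2; lra.
Qed.

(** The two ways for an arc to end: arrival at a guard, or a moment that is still good but after
    which these pivots fail, so that they have to be changed. *)
Definition ends_before_bad l r t : Prop :=
  apex Theta l r t \in G \/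
  (good G Theta l r t /\ ~ \forall x \near t^'+, good G Theta l r x).

Lemma arc l r phi B : state G Theta phi l r ->
  phi < B <= phi + pi - Theta -> cross (r - l) (dir (B + Theta)) <= 0 ->
  exists t, [/\ phi < t <= B, forall x, phi < x < t -> good G Theta l r x,
    empty_cone G Theta (apex Theta l r t) t,
    forall x, phi <= x <= t -> 0 <= cross (r - l) (dir (x + Theta))
    & ends_before_bad l r t].
Proof.
move=> st hB aB.
pose Bad := [set x | phi < x /\ ~ good G Theta l r x].
have [e e0 he] : exists2 e, 0 < e & forall x, phi < x < phi + e -> good G Theta l r x.
  by apply/at_rightP; exact: advance.
(* Where the form vanishes the apex is the guard [r], which makes the moment bad. So a bad moment
   exists up to [B], and the arc ends at the infimum [t] of all bad moments. *)
have zero x : phi < x -> cross (r - l) (dir (x + Theta)) <= 0 ->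
    exists2 y, phi < y <= x & Bad y /\ cross (r - l) (dir (y + Theta)) = 0.
  move=> px ax; have [|||y] := @IVT R (fun x => cross (r - l) (dir (x + Theta))) phi x 0.
  - exact: ltW.
  - by apply: continuous_subspaceT; exact: continuous_cross_dir.
  - by rewrite ge_min le_max ax (ltW (st_a st)) orbT.
  rewrite in_itv /= => hy ay; have py : phi < y.
    rewrite lt_neqAle; case/andP: hy => -> _; rewrite andbT.
    by apply/eqP => yp; have := st_a st; rewrite yp ay ltxx.
  exists y; first by rewrite py; case/andP: hy.
  split=> //; split => // -[_]; rewrite (proj1 (apex_eq_r hT l r y) ay).
  by rewrite (st_r st).
have lbB : lbound Bad (phi + e).
  by move=> x [px nx]; rewrite leNgt; apply/negP => xe; apply: nx; apply: he; lra.
have [b0 hb0 [Bb0 _]] := zero B (ltac:(lra)) aB.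
have hiB : has_inf Bad by split; [exists b0|exists (phi + e)].
pose t := inf Bad.
have pt : phi < t by apply: lt_le_trans (lb_le_inf hiB.1 lbB); lra.
have tB x : Bad x -> t <= x by move=> Bx; apply: ge_inf => //; exact: hiB.2.
have gd x : phi < x < t -> good G Theta l r x.
  move=> hx; apply: contrapT => nx; have : t <= x by apply: tB; split=> //; lra.
  by lra.
(* The cone is open, so a guard inside it at [t] would have been inside shortly before. *)
have em : empty_cone G Theta (apex Theta l r t) t.
  apply/(empty_apexP G hT) => g gG [h1 h2].
  have [x hx [k1 k2]] : exists2 x, phi < x < t &
      0 < cross (r - g) (dir x) /\ 0 < cross (g - l) (dir (x + Theta)).
    apply: near_left_witness pt _; apply: filterI; last first.
      by apply: near_left_pos => //; exact: continuous_cross_dir.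
    apply: near_left_pos; first exact: continuous_cross_dir0.
    by rewrite -cross_flip.
  have [/(empty_apexP G hT)/(_ g gG) nk _] := gd x hx; apply: nk; split => //.
  by rewrite cross_flip.
exists t; split => //.
- by rewrite pt /=; apply: le_trans (tB _ Bb0) _; case/andP: hb0.
- move=> x hx; rewrite leNgt; apply/negP => ax.
  have px : phi < x.
    rewrite lt_neqAle; case/andP: hx => -> _; rewrite andbT; apply/eqP => xp.
    by have := st_a st; rewrite xp; lra.
  have [y hy [By ay]] := zero x px (ltW ax).
  have yx : y = x by have := tB _ By; lra.
  by move: ax; rewrite -yx ay ltxx.
have [tG|tG] := boolP (apex Theta l r t \in G); [by left|right].
have gt_ : good G Theta l r t by [].
split=> // /at_rightP[d d0 hd].
have [x Bx xd] := inf_adherent d0 hiB.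
have tx := tB _ Bx; have [xt|xt] := eqVneq x t; first by case: Bx => _; rewrite xt.
by case: Bx => _; apply; apply: hd; rewrite lt_neqAle eq_sym xt tx.
Qed.

(** The claim concerns all touched pairs, not only the pivots, so that two motions can be joined
    through any pair touched at the joint. Moments with the apex in [G] are excluded because the
    apex is then a degenerate choice for [l1], [r1], [l2] or [r2]. *)
Definition monot a b q : Prop := forall x1 x2 l1 r1 l2 r2,
  a <= x1 -> x1 < x2 -> x2 <= b ->
  touch G Theta (q x1) x1 l1 r1 -> touch G Theta (q x2) x2 l2 r2 ->
  q x1 \notin G -> q x2 \notin G ->
  between (x1 + Theta) (x2 + Theta) (l2 - l1) /\ between x1 x2 (r1 - r2).

Record motion a b q : Prop := Motion {
  mo_lt : a < b;
  mo_cont : {within `[a, b], continuous q};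
  mo_empty : forall x, a <= x <= b -> empty_cone G Theta (q x) x;
  mo_touch : forall x, a <= x <= b -> exists l r, touch G Theta (q x) x l r;
  mo_free : forall x, a < x < b -> q x \notin G;
  mo_monot : monot a b q }.

Definition splice t q1 q2 x : R * R := if x <= t then q1 x else q2 x.

Lemma spliceL t q1 q2 x : x <= t -> splice t q1 q2 x = q1 x.
Proof. by rewrite /splice => ->. Qed.

Lemma spliceR t q1 q2 x : q1 t = q2 t -> t <= x -> splice t q1 q2 x = q2 x.
Proof.
by move=> e tx; rewrite /splice; case: ifP => // xt; have -> : x = t by lra.
Qed.

Lemma motion_splice a t b q1 q2 : motion a t q1 -> motion t b q2 ->
  q1 t = q2 t -> q1 t \notin G -> b - a < pi -> motion a b (splice t q1 q2).
Proof.
move=> [at_ c1 e1 t1 f1 m1] [tb c2 e2 t2 f2 m2] e12 tG bapi; split.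
- exact: lt_trans tb.
- have -> : `[a, b]%classic = `[a, t]%classic `|` `[t, b]%classic.
    by apply/seteqP; split=> x /=; rewrite !in_itv /=; [|case]; lra.
  apply: withinU_continuous; try exact: itv_closed.
    apply: (subspace_eq_continuous (f := q1)) c1 => x.
    rewrite inE /= in_itv /= => hx; rewrite /from_subspace.
    by rewrite spliceL//; lra.
  apply: (subspace_eq_continuous (f := q2)) c2 => x.
  rewrite inE /= in_itv /= => hx; rewrite /from_subspace.
  by rewrite spliceR//; lra.
- move=> x hx; have [xt|xt] := lerP x t.
    by rewrite spliceL//; apply: e1; lra.
  by rewrite spliceR//; [apply: e2; lra|exact: ltW].
- move=> x hx; have [xt|xt] := lerP x t.
    by rewrite spliceL//; apply: t1; lra.
  by rewrite spliceR//; [apply: t2; lra|exact: ltW].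
- move=> x hx; have [xt|xt|->] := ltgtP x t.
  + by rewrite spliceL; [apply: f1|]; lra.
  + by rewrite spliceR//; [apply: f2|]; lra.
  + by rewrite spliceL.
move=> x1 x2 l1 r1 l2 r2 ax x12 xb.
have [x2t|x2t] := lerP x2 t.
  by rewrite !spliceL//; [exact: m1|lra].
have [x1t|x1t] := lerP t x1.
  by rewrite !spliceR//; [exact: m2|lra].
rewrite spliceL ?ltW// spliceR ?ltW// => h1 h2 n1 n2.
(* A pair touched at the joint links both halves. The sectors of the halves lie in the sector of the
   whole turn because that turn is shorter than [pi]. *)
have [lt [rt ht]] := t2 t (ltac:(lra)).
have [bl br] := m2 t x2 lt rt l2 r2 (lexx _) x2t xb ht h2 (ltac:(by rewrite -e12)) n2.
rewrite -e12 in ht.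
have [bl' br'] := m1 x1 t l1 r1 lt rt ax x1t (lexx _) h1 ht n1 tG.
split.
  rewrite -(subrK lt l2) -addrA; apply: betweenD;
    by [apply: (between_widen _ _ _ _ bl); lra|apply: (between_widen _ _ _ _ bl'); lra].
rewrite -(subrK rt r1) -addrA; apply: betweenD;
  by [apply: (between_widen _ _ _ _ br'); lra|apply: (between_widen _ _ _ _ br); lra].
Qed.

Lemma continuous_apex l r : continuous (apex Theta l r).
Proof.
suff key (x : R) : apex Theta l r y @[y --> x] --> apex Theta l r x by move=> x; exact: key.
have ca : (cross (r - l) (dir (y + Theta)) / sin Theta) @[y --> x] -->
    cross (r - l) (dir (x + Theta)) / sin Theta.
  by apply: cvgM; [exact: continuous_cross_dir|exact: cvg_cst].
have cd : dir y @[y --> x] --> dir x.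
  exact: (@cvg_pair _ _ _ (nbhs x) (nbhs (cos x)) (nbhs (sin x)) _ _ _ cos sin
    (@continuous_cos R x) (@continuous_sin R x)).
have h := @cvgZ _ _ _ _ _ _ _ _ _ ca cd.
have h2 : (fun=> r : R * R) @ x --> r by apply: cvg_cst.
exact: (@cvgB _ _ _ _ _ _ _ _ _ h2 (h (nbhs_filter x))).
Qed.

Lemma state_arc_left l r phi t x : state G Theta phi l r ->
  phi < t <= phi + pi - Theta ->
  (forall x, phi <= x <= t -> 0 <= cross (r - l) (dir (x + Theta))) ->
  phi < x <= t -> 0 < cross (r - l) (dir x).
Proof.
move=> st ht at_ hx; apply: (@left_pivot_pos _ phi).
- exact: st_a st.
- exact: st_b st.
- lra.
- by apply: at_; lra.
Qed.

Lemma arc_touch l r phi t : state G Theta phi l r ->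
  phi < t <= phi + pi - Theta ->
  (forall x, phi <= x <= t -> 0 <= cross (r - l) (dir (x + Theta))) ->
  forall x, phi <= x <= t -> touch G Theta (apex Theta l r x) x l r.
Proof.
move=> st ht at_ x hx; split; [exact: st_l st|exact: st_r st| |].
  apply: apex_left_ray => //; have [->|xn] := eqVneq x phi; first exact: st_b st.
  apply/ltW/(state_arc_left st ht at_); rewrite lt_neqAle eq_sym xn.
  by case/andP: hx => -> ->.
by apply: apex_right_ray => //; exact: at_.
Qed.

(** Monotonicity on one arc goes through the pivots. At [x1] no left guard is beyond [l] and no
    right guard before [r], or it would enter the cone just after; at [x2] it is the other way
    round, or it would have been inside just before. So [l2 - l1] splits at [l] into a part along
    each left ray, and [r1 - r2] splits at [r]. *)
Lemma arc_motion l r phi t : state G Theta phi l r ->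
  phi < t <= phi + pi - Theta ->
  (forall x, phi < x < t -> good G Theta l r x) ->
  empty_cone G Theta (apex Theta l r t) t ->
  (forall x, phi <= x <= t -> 0 <= cross (r - l) (dir (x + Theta))) ->
  motion phi t (apex Theta l r).
Proof.
move=> st ht gd em at_.
have tch := arc_touch st ht at_.
split.
- by case/andP: ht.
- by apply: continuous_subspaceT; exact: continuous_apex.
- move=> x hx; have [->|xp] := eqVneq x phi; first exact: st_empty st.
  have [->//|xt] := eqVneq x t.
  have [] : good G Theta l r x; last by [].
  by apply: gd; rewrite lt_neqAle eq_sym xp lt_neqAle xt; case/andP: hx => -> ->.
- by move=> x hx; exists l, r; exact: tch.
- by move=> x hx; case: (gd x hx).
move=> x1 x2 l1 r1 l2 r2 h1 h12 h2 [l1G r1G l1q r1q] [l2G r2G l2q r2q] n1 n2.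
have [_ _ lq1 rq1] := tch x1 (ltac:(lra)); have [_ _ lq2 rq2] := tch x2 (ltac:(lra)).
have pos_after g : g \in G ->
    (0 < cross (dir x1) (g - apex Theta l r x1) \/
      (exists2 c, 0 < c & g - r = - (c *: dir x1))) ->
    (0 < cross (g - apex Theta l r x1) (dir (x1 + Theta)) \/
      (exists2 c, 0 < c & g - l = c *: dir (x1 + Theta))) -> x1 < t -> False.
  move=> gG A B x1t.
  have [y hy [k1 k2]] : exists2 y, x1 < y < t &
      0 < cross (dir y) (g - r) /\ 0 < cross (g - l) (dir (y + Theta)).
    apply: near_right_witness x1t _; apply: filterI.
      case: A => [|[c c0 gE]].
        rewrite cross_apex_r// cross_flip => h.
        near=> y; rewrite cross_flip; near: y.
        by apply: near_right_pos => //; exact: continuous_cross_dir0.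
      near=> y; rewrite gE crossNr crossZr cross_dir -mulrN -sinN opprB.
      by apply: mulr_gt0 => //; near: y; exact: sin_near_right.
    case: B => [|[c c0 gE]].
      rewrite cross_apex_l// => h.
      by apply: near_right_pos => //; exact: continuous_cross_dir.
    near=> y; rewrite gE crossZl cross_dir sDT.
    by apply: mulr_gt0 => //; near: y; exact: sin_near_right.
  have [/(empty_apexP G hT)/(_ g gG) nk _] := gd y (ltac:(lra)); exact: nk.
have pos_before g : g \in G ->
    (0 < cross (dir x2) (g - apex Theta l r x2) \/
      (exists2 c, 0 < c & g - r = c *: dir x2)) ->
    (0 < cross (g - apex Theta l r x2) (dir (x2 + Theta)) \/
      (exists2 c, 0 < c & g - l = - (c *: dir (x2 + Theta)))) -> phi < x2 -> False.
  move=> gG A B px2.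
  have [y hy [k1 k2]] : exists2 y, phi < y < x2 &
      0 < cross (dir y) (g - r) /\ 0 < cross (g - l) (dir (y + Theta)).
    apply: near_left_witness px2 _; apply: filterI.
      case: A => [|[c c0 gE]].
        rewrite cross_apex_r// cross_flip => h.
        near=> y; rewrite cross_flip; near: y.
        by apply: near_left_pos => //; exact: continuous_cross_dir0.
      near=> y; rewrite gE crossZr cross_dir.
      by apply: mulr_gt0 => //; near: y; exact: sin_near_left.
    case: B => [|[c c0 gE]].
      rewrite cross_apex_l// => h.
      by apply: near_left_pos => //; exact: continuous_cross_dir.
    near=> y; rewrite gE crossNl crossZl cross_dir sDT -mulrN -sinN opprB.
    by apply: mulr_gt0 => //; near: y; exact: sin_near_left.
  have [/(empty_apexP G hT)/(_ g gG) nk _] := gd y (ltac:(lra)); exact: nk.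
have ray_pos (u w : R * R) x s : w = u + s *: dir x -> w \in G -> u \notin G -> 0 <= s -> 0 < s.
  move=> wE wG uG s0; rewrite lt_def s0 andbT; apply/eqP => s00.
  by move: uG; rewrite -(addr0 u) -(scale0r (dir x)) -s00 -wE wG.
have [a1 a1p l1E] := l1q; have [b1 b1p r1E] := r1q.
have [a2 a2p l2E] := l2q; have [b2 b2p r2E] := r2q.
have [a a_p lE] := lq1; have [b b_p rE] := rq1.
have [a' a'_p lE'] := lq2; have [b' b'_p rE'] := rq2.
have := ray_pos _ _ _ _ l1E l1G n1 a1p; have := ray_pos _ _ _ _ r1E r1G n1 b1p.
have := ray_pos _ _ _ _ l2E l2G n2 a2p; have := ray_pos _ _ _ _ r2E r2G n2 b2p.
move=> b20 a20 b10 a10.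
have aa1 : a1 <= a.
  rewrite leNgt; apply/negP => h; apply: (pos_after l1 l1G); last by lra.
    by left; rewrite l1E addrC addKr crossZr cross_dir sTx; exact: mulr_gt0.
  right; exists (a1 - a); first by rewrite subr_gt0.
  by rewrite (sub_ray (apex Theta l r x1)) -l1E -lE.
have bb1 : b <= b1.
  rewrite leNgt; apply/negP => h; apply: (pos_after r1 r1G); last by lra.
    right; exists (b - b1); first by rewrite subr_gt0.
    by rewrite -scaleNr opprB (sub_ray (apex Theta l r x1)) -r1E -rE.
  by left; rewrite r1E addrC addKr crossZl cross_dir sTx; exact: mulr_gt0.
have aa2 : a' <= a2.
  rewrite leNgt; apply/negP => h; apply: (pos_before l2 l2G); last by lra.
    by left; rewrite l2E addrC addKr crossZr cross_dir sTx; exact: mulr_gt0.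
  right; exists (a' - a2); first by rewrite subr_gt0.
  by rewrite -scaleNr opprB (sub_ray (apex Theta l r x2)) -l2E -lE'.
have bb2 : b2 <= b'.
  rewrite leNgt; apply/negP => h; apply: (pos_before r2 r2G); last by lra.
    right; exists (b2 - b'); first by rewrite subr_gt0.
    by rewrite (sub_ray (apex Theta l r x2)) -r2E -rE'.
  by left; rewrite r2E addrC addKr crossZl cross_dir sTx; exact: mulr_gt0.
have e1 : l - l1 = (a - a1) *: dir (x1 + Theta).
  by rewrite (sub_ray (apex Theta l r x1)) -l1E -lE.
have e2 : l2 - l = (a2 - a') *: dir (x2 + Theta).
  by rewrite (sub_ray (apex Theta l r x2)) -l2E -lE'.
have e3 : r1 - r = (b1 - b) *: dir x1.
  by rewrite (sub_ray (apex Theta l r x1)) -r1E -rE.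
have e4 : r - r2 = (b' - b2) *: dir x2.
  by rewrite (sub_ray (apex Theta l r x2)) -r2E -rE'.
split.
  exists (a - a1), (a2 - a'); split; rewrite ?subr_ge0//.
  by rewrite -(subrK l l2) -addrA e1 e2 addrC.
exists (b1 - b), (b' - b2); split; rewrite ?subr_ge0//.
by rewrite -(subrK r r1) -addrA e3 e4.
Unshelve. all: by end_near.
Qed.

Lemma exists_state p phi : empty_cone G Theta p phi ->
  (exists2 l, l \in G & left_ray Theta p phi l) ->
  (exists2 r, r \in G & right_ray p phi r /\ r <> p) ->
  exists l r, state G Theta phi l r /\ apex Theta l r phi = p.
Proof.
(* [cross (dir phi)] grows along the left ray, so its negative is least at the farthest guard. The
   form minimized next grows along the right ray and picks the nearest guard other than the apex. *)
move=> em /(fset_argmin (fun g => - cross (dir phi) g)).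
move=> [l [lG [lam lam0 lE] lmax]].
move=> /(fset_argmin (fun g => cross g (dir (phi + Theta)))).
move=> [r [rG [[rho rho0 rE] rp] rmin]].
have pE : apex Theta l r phi = p.
  by rewrite -(@rays_apex _ _ hT p)//; [exists lam|exists rho].
have rhop : 0 < rho.
  rewrite lt_def rho0 andbT; apply/eqP => z; apply: rp.
  by rewrite rE z scale0r addr0.
have rl : r - l = rho *: dir phi - lam *: dir (phi + Theta).
  by rewrite rE lE opprD addrACA subrr add0r.
exists l, r; split => //; split => //.
- by rewrite rl crossDl crossNl !crossZl !cross_dir subrr sin0 sTx mulr0 subr0 mulr_gt0.
- rewrite rl crossDl crossNl !crossZl !cross_dir subrr sin0 mulr0 add0r.
  by rewrite -mulrN -sinN opprB sTx mulr_ge0// ltW.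
- by rewrite pE.
- rewrite pE => g gG gp; have [s s0 gE] := gp; exists (lam - s).
    have := lmax g gG gp; rewrite lE gE !crossDr !crossZr cross_dir sTx => k.
    by rewrite subr_ge0 -(ler_pM2r sT); lra.
  by rewrite (sub_ray p) -lE -gE addrC subrK.
rewrite pE => g gG gp gn; have [s s0 gE] := gp; exists (s - rho).
  have := rmin g gG (conj gp gn); rewrite rE gE !crossDl !crossZl cross_dir sTx => k.
  by rewrite subr_ge0 -(ler_pM2r sT); lra.
by rewrite (sub_ray p) -rE -gE addrC subrK.
Qed.

Definition bounded_touch a b q l r : Prop :=
  forall x, a <= x <= b -> touch G Theta (q x) x l r.

(** The hypothesis on [B] survives a change of pivots at [t]: the new [r2 - l2] is [r - l] minus
    nonnegative multiples of [dir t] and [dir (t + Theta)], and both directions have a nonnegative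
    cross product with [dir (B + Theta)]. *)
Lemma extend phi l r B : state G Theta phi l r ->
  phi < B <= phi + pi - Theta -> cross (r - l) (dir (B + Theta)) <= 0 ->
  exists hi q, [/\ hi <= B, q phi = apex Theta l r phi, motion phi hi q,
    (exists2 t, phi < t <= hi & bounded_touch phi t q l r)
    & q hi \in G /\ exists t l' r',
        [/\ phi <= t < hi, bounded_touch t hi q l' r' & q hi <> l']].
Proof.
(* [f] decreases along the right guards and increases along the left guards, so
   [m] bounds the number of changes of guards that are still to come. *)
pose f (g : R * R) := cross g (dir (B + Theta)).
pose m l r := (#|` [fset g in G | (f g < f r)%R]%fset| + #|` [fset g in G | (f l < f g)%R]%fset|)%N.
have [n] := ubnP (m l r).
elim: n phi l r => // n ih phi l r; rewrite ltnS => mn st hB aB.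
have [t [ht gd em at_ eb]] := arc st hB aB.
have ht' : phi < t <= phi + pi - Theta by lra.
have mo := arc_motion st ht' gd em at_.
have tch := arc_touch st ht' at_.
have bt : 0 < cross (r - l) (dir t) by apply: (state_arc_left st ht' at_); lra.
have [tG|[gt_ nadv]] := eb.
  exists t, (apex Theta l r); split => //; first by case/andP: ht.
    by exists t => //; rewrite (mo_lt mo) lexx.
  split=> //; exists phi, l, r; split => //; first by rewrite lexx (mo_lt mo).
  by move/(apex_eq_l hT) => e; rewrite e ltxx in bt.
pose p := apex Theta l r t.
have tchp : touch G Theta p t l r by apply: tch; lra.
have pG : p \notin G by case: gt_.
have [lG rG lp rp] := tchp.
have [||l2 [r2 [st2 p2]]] := @exists_state p t em; first by exists l.
  by exists r => //; split => // e; rewrite -e rG in pG.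
have l2G := st_l st2; have r2G := st_r st2.
have [|c c0 l2l] := st_far st2 lG; first by rewrite p2.
have [||d d0 rr2] := st_near st2 rG; first by rewrite p2.
  by rewrite p2 => e; rewrite -e rG in pG.
(* At [t = B] the form would vanish and the apex would be [r], contrary to [pG]. *)
have tB : t < B.
  rewrite lt_neqAle; case/andP: ht => _ ->; rewrite andbT; apply/eqP => tBe.
  have := at_ t; rewrite lexx ltW ?(mo_lt mo)// => /(_ isT); rewrite tBe => k.
  have /(apex_eq_r hT) e : cross (r - l) (dir (B + Theta)) = 0 by apply: le_anti; rewrite aB k.
  by move: pG; rewrite /p tBe e rG.
have s1 : 0 < sin (B - t) by apply: sin_gt0_pi'; tlra.
have s2 : 0 < sin (B + Theta - t) by apply: sin_gt0_pi'; tlra.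
have fl : f l2 = f l + c * sin (B - t).
  by rewrite /f l2l crossDl crossZl cross_dir; congr (_ + _ * sin _); ring.
have fr : f r = f r2 + d * sin (B + Theta - t).
  by rewrite /f rr2 crossDl crossZl cross_dir.
have fl' : f l <= f l2 by rewrite fl lerDl mulr_ge0// ltW.
have fr' : f r2 <= f r by rewrite fr lerDl mulr_ge0// ltW.
have ml : (#|` [fset g in G | (f l2 < f g)%R]%fset| <= #|` [fset g in G | (f l < f g)%R]%fset|)%N.
  apply: fsubset_leq_card; apply/fsubsetP => g; rewrite !inE /= => /andP[-> /=].
  exact: le_lt_trans.
have mr : (#|` [fset g in G | (f g < f r2)%R]%fset| <= #|` [fset g in G | (f g < f r)%R]%fset|)%N.
  apply: fsubset_leq_card; apply/fsubsetP => g; rewrite !inE /= => /andP[-> /= k].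
  exact: lt_le_trans fr'.
have m2 : (m l2 r2 < n)%N.
  apply: leq_trans mn; rewrite /m.
  have [cz|cn] := eqVneq c 0; last first.
    rewrite -addnS; apply: leq_add => //; apply: (@fset_card_lt _ _ _ _ l2) => //.
    - by move=> g; exact: le_lt_trans.
    - by rewrite fl ltrDl mulr_gt0// lt_def cn.
    - by rewrite ltxx.
  have [dz|dn] := eqVneq d 0; last first.
    rewrite -addSn; apply: leq_add => //; apply: (@fset_card_lt _ _ _ _ r2) => //.
    - by move=> g k; exact: lt_le_trans fr'.
    - by rewrite fr ltrDl mulr_gt0// lt_def dn.
    - by rewrite ltxx.
  (* If neither pivot changes, the old pair is a [state] at [t] and the turn could have gone on. *)
  exfalso; apply: nadv.
  have -> : l = l2 by rewrite l2l cz scale0r addr0.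
  have -> : r = r2 by rewrite rr2 dz scale0r addr0.
  exact: advance.
have [||hi [q [hiB qt mo2 [t2 ht2 tch2] [qG [t3 [l' [r' [ht3 tch3 ql']]]]]]]] :=
    ih t l2 r2 m2 st2.
- by rewrite tB /=; lra.
- have -> : r2 - l2 = (r - l) - (d *: dir t) - c *: dir (t + Theta).
    rewrite rr2 l2l; apply: pairE => /=; ring.
  move: aB; rewrite !crossDl !crossNl !crossZl !cross_dir.
  have -> : B + Theta - (t + Theta) = B - t by ring.
  by have := mulr_ge0 c0 (ltW s1); have := mulr_ge0 d0 (ltW s2); lra.
have thi := mo_lt mo2; have pt := mo_lt mo.
have eqt : apex Theta l r t = q t by rewrite qt p2.
exists hi, (splice t (apex Theta l r) q); split => //.
- by rewrite spliceL// ltW.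
- by apply: motion_splice => //; tlra.
- exists t; first by lra.
  by move=> x hx; rewrite spliceL; [exact: tch|lra].
split; first by rewrite spliceR// ltW.
exists t3, l', r'; split; first by lra.
  by move=> x hx; rewrite spliceR//; [exact: tch3|lra].
by rewrite spliceR// ltW.
Qed.

End Extension.

(** * Reflection, which exchanges the two senses of turning *)

Section Mirror.
Context {R : realType}.
Implicit Types (u v p g : R * R) (phi a b x Theta : R) (G : {fset R * R}).

Definition mirror u : R * R := (u.1, - u.2).

Lemma mirrorK : involutive mirror.
Proof. by move=> u; apply: pairE => //=; rewrite opprK. Qed.

Lemma mirrorD u v : mirror (u + v) = mirror u + mirror v.
Proof. by apply: pairE => //=; ring. Qed.

Lemma mirrorB u v : mirror (u - v) = mirror u - mirror v.
Proof. by apply: pairE => //=; ring. Qed.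

Lemma mirrorZ x u : mirror (x *: u) = x *: mirror u.
Proof. by apply: pairE; rewrite !scaleE //=; ring. Qed.

Lemma mirror_dir a : mirror (dir a) = dir (- a).
Proof. by apply: pairE; rewrite /= ?cosN ?sinN. Qed.

Lemma cross_mirror u v : cross (mirror u) (mirror v) = - cross u v.
Proof. by rewrite /cross /=; ring. Qed.

Lemma mirror_inj : injective mirror.
Proof. exact: inv_inj mirrorK. Qed.

Lemma ray_mirror p phi g : ray p phi g -> ray (mirror p) (- phi) (mirror g).
Proof.
by move=> [t t0 ->]; exists t => //; rewrite mirrorD mirrorZ mirror_dir.
Qed.

Lemma between_mirror a b v : between a b v -> between (- b) (- a) (mirror v).
Proof.
move=> [x [y [x0 y0 ->]]]; exists y, x; split=> //.
by rewrite mirrorD !mirrorZ !mirror_dir addrC.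
Qed.

Definition mirror_set G : {fset R * R} := [fset mirror g | g in G]%fset.

Lemma in_mirror_set G g : (g \in mirror_set G) = (mirror g \in G).
Proof.
apply/imfsetP/idP => [[h hG ->]|gG]; first by rewrite mirrorK.
by exists (mirror g); rewrite // mirrorK.
Qed.

Lemma mirror_setK G : mirror_set (mirror_set G) = G.
Proof. by apply/fsetP => g; rewrite !in_mirror_set mirrorK. Qed.

(** Reflection exchanges the rays: the right ray of the image is the reflected left ray, hence the
    new direction [- (phi + Theta)]. *)
Lemma touch_mirror G Theta p phi l r : touch G Theta p phi l r ->
  touch (mirror_set G) Theta (mirror p) (- phi - Theta) (mirror r) (mirror l).
Proof.
move=> [lG rG lp rp]; split; rewrite ?in_mirror_set ?mirrorK//.
  by rewrite /left_ray subrK; exact: ray_mirror.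
by rewrite /right_ray -opprD; exact: ray_mirror.
Qed.

Lemma empty_mirror G Theta p phi : 0 < Theta < pi -> empty_cone G Theta p phi ->
  empty_cone (mirror_set G) Theta (mirror p) (- phi - Theta).
Proof.
move=> hT /(empty_coneP G hT) em; apply/(empty_coneP _ hT) => g.
rewrite in_mirror_set subrK -opprD -!mirror_dir -[g]mirrorK -!mirrorB !cross_mirror.
rewrite mirrorK => gG [h1 h2]; apply: (em _ gG).
by rewrite ![cross _ (dir _)]crossC [cross (dir phi) _]crossC.
Qed.

Lemma mirror_continuous : continuous mirror.
Proof.
case=> a b.
have c1 : v.1 @[v --> (a, b)] --> a by exact: cvg_fst.
have c2 : v.2 @[v --> (a, b)] --> b by exact: cvg_snd.
have c3 := cvg_comp _ _ c2 (@opp_continuous _ b).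
exact: (@cvg_pair _ _ _ (nbhs (a, b)) (nbhs a) (nbhs (- b)) _ _ _ fst
  (fun v => - v.2) c1 c3).
Qed.

Lemma motion_mirror G Theta a b (q : R -> R * R) : 0 < Theta < pi ->
  motion G Theta a b q ->
  motion (mirror_set G) Theta (- b - Theta) (- a - Theta)
    (fun x => mirror (q (- x - Theta))).
Proof.
move=> hT [ab cq eq tq fq mq].
have inv x : - (- x - Theta) - Theta = x by ring.
split.
- by rewrite ltrBlDr subrK ltrN2.
- apply/subspace_continuousP => x; rewrite /= in_itv /= => hx.
  move/subspace_continuousP : cq => /(_ (- x - Theta)) cq.
  have qx : q y @[y --> within `[a, b] (nbhs (- x - Theta))] --> q (- x - Theta).
    by apply: cq; rewrite /= in_itv /=; lra.
  have nx : (- y - Theta) @[y --> within `[(- b - Theta), (- a - Theta)] (nbhs x)]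
      --> within `[a, b] (nbhs (- x - Theta)).
    move=> W hW; have cn : (- y - Theta) @[y --> x] --> - x - Theta.
      have c1 := @opp_continuous R x.
      exact: (@cvgB _ _ _ _ _ _ _ _ _ c1 (cvg_cst Theta)).
    have h1 : \forall y \near x, `[a, b]%classic (- y - Theta) -> W (- y - Theta).
      exact: (cn _ hW).
    have h2 : \forall y \near x,
        `[(- b - Theta), (- a - Theta)]%classic y -> W (- y - Theta).
      apply: filterS h1 => y hy ay; apply: hy; move: ay; rewrite /= !in_itv /=; lra.
    exact: h2.
  have h := cvg_comp _ _ nx qx.
  exact: (cvg_comp _ _ h (@mirror_continuous (q (- x - Theta)))).
- move=> x hx; have := empty_mirror hT (eq (- x - Theta) (ltac:(lra))).
  by rewrite inv.
- move=> x hx; have [l [r h]] := tq (- x - Theta) (ltac:(lra)).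
  by exists (mirror r), (mirror l); have := touch_mirror h; rewrite inv.
- by move=> x hx; rewrite in_mirror_set mirrorK; apply: fq; lra.
move=> x1 x2 l1 r1 l2 r2 ax x12 xb /touch_mirror h1 /touch_mirror h2.
rewrite !in_mirror_set !mirrorK => n1 n2; rewrite !mirrorK mirror_setK in h1 h2.
have [bl br] := mq (- x2 - Theta) (- x1 - Theta) _ _ _ _ (ltac:(lra)) (ltac:(lra))
  (ltac:(lra)) h2 h1 n2 n1.
move: bl br; rewrite !subrK => /between_mirror bl /between_mirror br.
move: bl br; rewrite !mirrorB !mirrorK !opprK.
have -> : - (- x1 - Theta) = x1 + Theta by ring.
by have -> : - (- x2 - Theta) = x2 + Theta by ring.
Qed.

End Mirror.

(** * Motions from guard to guard *)

Section Completion.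
Context {R : realType}.
Variables (G : {fset R * R}) (Theta : R).
Hypothesis hT : 0 < Theta < pi.
Implicit Types (p l r g : R * R) (q : R -> R * R) (phi x t a b B : R).

Ltac tlra := have /andP[? ?] := hT; lra.

Definition starts_with a b q l r : Prop :=
  exists2 t, a < t <= b & bounded_touch G Theta a t q l r.

Definition ends_with a b q l r : Prop :=
  exists2 t, a <= t < b & bounded_touch G Theta t b q l r.

(** At both ends the apex is a guard and touches itself. The pairs in [co_start] and [co_end] are
    touched on a whole interval, so what is known at inner moments about these pairs can be used at
    the ends. *)
Record complete a b q : Prop := Complete {
  co_motion : motion G Theta a b q;
  co_range : b - a <= pi - Theta;
  co_guards : q a \in G /\ q b \in G;
  co_start : exists l r, starts_with a b q l r /\ q a <> r;
  co_end : exists l r, ends_with a b q l r /\ q b <> l }.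

Lemma complete_from_guard p phi : p \in G -> empty_cone G Theta p phi ->
  (exists2 r, r \in G & right_ray p phi r /\ r <> p) ->
  exists hi q l r, [/\ complete phi hi q, q phi = p & starts_with phi hi q l r].
Proof.
move=> pG em hr; have [|l [r [st pE]]] := exists_state hT em _ hr.
  by exists p => //; exists 0 => //; rewrite scale0r addr0.
(* For [B = phi + pi - Theta] the direction [dir (B + Theta)] is [- dir phi], and [st_b] gives the
   sign. *)
have aB : cross (r - l) (dir (phi + pi - Theta + Theta)) <= 0.
  by rewrite subrK dirDpi crossNr oppr_le0 (st_b st).
have hB : phi < phi + pi - Theta <= phi + pi - Theta by tlra.
have [hi [q [hiB qp mo [t ht tch] [qG [t' [l' [r' [ht' tch' ql']]]]]]]] :=
  extend hT st hB aB.
exists hi, q, l, r; rewrite qp pE; split => //; last by exists t.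
split => //.
- by lra.
- by rewrite qp pE.
- exists l, r; split; first by exists t.
  rewrite qp => e; have := st_a st.
  by move/(apex_eq_r hT) : e => ->; rewrite ltxx.
- by exists l', r'; split => //; exists t'.
Qed.

End Completion.

Lemma state_touch (R : realType) (G : {fset R * R}) Theta phi (l r : R * R) :
  0 < Theta < pi -> state G Theta phi l r ->
  touch G Theta (apex Theta l r phi) phi l r.
Proof.
move=> hT st; split; [exact: st_l st|exact: st_r st| |].
  exact: apex_left_ray (st_b st).
exact: apex_right_ray (ltW (st_a st)).
Qed.

Section Through.
Context {R : realType}.
Variables (G : {fset R * R}) (Theta : R).
Hypothesis hT : 0 < Theta < pi.
Implicit Types (p l r g : R * R) (q : R -> R * R) (phi x t a b B : R).

Ltac tlra := have /andP[? ?] := hT; lra.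

(** Bounding the two turns separately by [pi - Theta] would only give twice that for the whole.
    Instead both are bounded through one moment [B], at which turning about [l] and [r] would bring
    the apex to [r]: the counterclockwise turn ends by [B], the clockwise one not beyond
    [B - (pi - Theta)]. *)
Lemma complete_through p phi : p \notin G -> empty_cone G Theta p phi ->
  (exists l r, touch G Theta p phi l r) ->
  exists lo hi q l r, [/\ complete G Theta lo hi q, lo < phi < hi, q phi = p
    & exists2 t, phi < t <= hi & bounded_touch G Theta phi t q l r].
Proof.
move=> pG em [l0 [r0 tch0]]; have [l0G r0G l0p r0p] := tch0.
have ne g : g \in G -> g <> p by move=> gG e; move: pG; rewrite -e gG.
have [||l [r [st pE]]] := exists_state hT em; [by exists l0|by exists r0; auto|].
have ha := st_a st; have hb := st_b st.
have hb' : 0 < cross (r - l) (dir phi).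
  rewrite lt_def hb andbT; apply/eqP => /(apex_eq_l hT).
  by rewrite pE => e; apply: (ne l (st_l st)).
have hT' : phi <= phi + pi - Theta by tlra.
have [|||B] := @IVT R (fun x => cross (r - l) (dir (x + Theta))) phi (phi + pi - Theta) 0.
- by [].
- by apply: continuous_subspaceT; exact: continuous_cross_dir.
- by rewrite subrK dirDpi crossNr ge_min le_max oppr_le0 hb (ltW ha) orbT.
rewrite in_itv /= => hB aB.
have pB : phi < B.
  rewrite lt_neqAle; case/andP: hB => -> _; rewrite andbT; apply/eqP => e.
  by move: ha; rewrite e aB ltxx.
have Bp : B < phi + pi - Theta.
  rewrite lt_neqAle; case/andP: hB => _ ->; rewrite andbT; apply/eqP => e.
  move: aB; rewrite e subrK dirDpi crossNr => /eqP; rewrite oppr_eq0 => /eqP z.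
  by rewrite z ltxx in hb'.
have [hi [q [hiB qp mo [t ht tch] [qG [t' [l' [r' [ht' tch' ql']]]]]]]] :=
  extend hT st (ltac:(lra) : phi < B <= phi + pi - Theta) (ltac:(by rewrite aB)).
have mtch0 := touch_mirror tch0.
have memp := empty_mirror hT em.
have mne : mirror p \notin mirror_set G by rewrite in_mirror_set mirrorK.
have [mr0G ml0G mr0p ml0p] := mtch0.
have [||l1 [r1 [st1 pE1]]] := exists_state hT memp.
- by exists (mirror r0).
- by exists (mirror l0) => //; split => // /mirror_inj; exact: ne.
have tch1 := state_touch hT st1; rewrite pE1 in tch1.
have := touch_mirror tch1; rewrite mirror_setK mirrorK.
have -> : - (- phi - Theta) - Theta = phi by ring.
(* The pivots of the clockwise turn: the nearest guard on the left ray and the farthest one on the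
   right ray. *)
set ln := mirror r1; set rf := mirror l1 => -[lnG rfG lnp rfp].
have [|c c0 lE] := st_far st lnG; first by rewrite pE.
have [||d d0 rE] := st_near st rfG; [by rewrite pE|by rewrite pE; exact: ne|].
pose B' := pi - B - 2 * Theta.
(* For the pair [l], [r] the reflected form would be zero at [B'], by the choice of [B]. Passing to
   [ln] and [rf] can only lower it. *)
have aB' : cross (r1 - l1) (dir (B' + Theta)) <= 0.
  have -> : dir (B' + Theta) = - mirror (dir (B + Theta)).
    by rewrite mirror_dir -dirDpi; congr dir; rewrite /B'; ring.
  have -> : r1 - l1 = mirror (ln - rf) by rewrite mirrorB !mirrorK.
  rewrite crossNr cross_mirror opprK.
  have -> : ln - rf = - (r - l) - c *: dir (phi + Theta) - d *: dir phi.
    by rewrite lE rE; apply: pairE => /=; ring.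
  rewrite crossDl crossNl crossZl crossDl crossNl aB crossNl crossZl !cross_dir.
  have s1 : 0 <= sin (B + Theta - (phi + Theta)) by apply: sin_ge0_pi'; tlra.
  have s2 : 0 <= sin (B + Theta - phi) by apply: sin_ge0_pi'; tlra.
  by have := mulr_ge0 c0 s1; have := mulr_ge0 d0 s2; lra.
have hB' : - phi - Theta < B' <= - phi - Theta + pi - Theta by rewrite /B'; lra.
have [hi1 [q1 [hiB1 qp1 mo1 _ [qG1 [t1 [l1' [r1' [ht1 tch1' ql1']]]]]]]] :=
  extend hT st1 hB' aB'.
have := motion_mirror hT mo1; rewrite mirror_setK.
have -> : - (- phi - Theta) - Theta = phi by ring.
set lo := - hi1 - Theta; set q0 := fun x => _ => mo0.
have q0phi : q0 phi = p.
  by rewrite /q0 qp1 pE1 mirrorK.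
have lop := mo_lt mo0; have phi_hi := mo_lt mo.
have range : hi - lo <= pi - Theta by rewrite /lo; move: hiB1; rewrite /B'; lra.
have eq0 : q0 phi = q phi by rewrite q0phi qp pE.
have hmo : motion G Theta lo hi (splice phi q0 q).
  by apply: motion_splice => //; [rewrite q0phi|tlra].
exists lo, hi, (splice phi q0 q), l, r; split.
- split => //.
  + rewrite spliceL ?ltW// spliceR ?ltW//; split => //.
    have -> : q0 lo = mirror (q1 hi1).
      by rewrite /q0 /lo; congr (mirror (q1 _)); ring.
    by rewrite -in_mirror_set.
  + exists (mirror r1'), (mirror l1'); split; last first.
      rewrite spliceL ?ltW//.
      have -> : q0 lo = mirror (q1 hi1).
        by rewrite /q0 /lo; congr (mirror (q1 _)); ring.
      by move/mirror_inj.
    exists (- t1 - Theta); first by rewrite /lo; lra.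
    move=> x hx; rewrite spliceL; last by lra.
    have := touch_mirror (tch1' (- x - Theta) (ltac:(move: hx; rewrite /lo; lra))).
    rewrite mirror_setK; have -> // : - (- x - Theta) - Theta = x by ring.
  + exists l', r'; split; last by rewrite spliceR// ltW.
    exists t'; first by lra.
    by move=> x hx; rewrite spliceR//; [exact: tch'|lra].
- by rewrite lop.
- by rewrite spliceL.
exists t => // x hx; rewrite spliceR//; [exact: tch|lra].
Qed.

End Through.

(** * Circular segments *)

Section Segments.
Context {R : realType}.
Variable Theta : R.
Hypothesis hT : 0 < Theta < pi.
Implicit Types (p q l r g u v w : R * R) (phi x y t a b c z s : R).

Ltac tlra := have /andP[? ?] := hT; lra.

Let sT : 0 < sin Theta. Proof. exact: sin_gt0_pi. Qed.
Let sT0 : sin Theta != 0. Proof. by rewrite gt_eqF. Qed.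

(* [sees u v >= 0] says that [v] is at an angle between [Theta] and [Theta + pi]
   counterclockwise from [u]. *)
Definition sees u v : R := cos Theta * cross u v - sin Theta * dot u v.

(** This is [sin Theta] times the negated power of the point [p] with respect to the circle of the
    arc: nonnegative on the disc and zero on the circle. *)
Definition power l r p : R := sees (r - p) (l - p).

Lemma sees_dir x v : sees (dir x) v = cross (dir (x + Theta)) v.
Proof. by rewrite /sees /cross /dot /dir /= cosD sinD; ring. Qed.

Lemma seesDl u w v : sees (u + w) v = sees u v + sees w v.
Proof. by rewrite /sees /cross /dot /=; ring. Qed.

Lemma seesZl s u v : sees (s *: u) v = s * sees u v.
Proof. by rewrite scaleE /sees /cross /dot /=; ring. Qed.

Lemma sees_mirror u v : sees (mirror v) (mirror u) = sees u v.
Proof. by rewrite /sees /cross /dot /mirror /=; ring. Qed.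

Lemma circular_segmentP l r p : circular_segment Theta l r p <->
  0 <= power l r p /\ 0 <= cross (l - r) (p - r).
Proof.
rewrite /circular_segment /left_halfplane /=.
suff -> : (sqdist p (circle_center Theta l r) <= sqdist l r / (2 * sin Theta) ^+ 2)
   = (0 <= power l r p) by [].
have -> : sqdist p (circle_center Theta l r) =
    sqdist l r / (2 * sin Theta) ^+ 2 - power l r p / sin Theta.
  have c2 : cos Theta ^+ 2 = 1 - sin Theta ^+ 2 by have := cos2Dsin2 Theta; lra.
  rewrite /sqdist /circle_center /power /sees /cross /dot !scaleE /=.
  case: l => l1 l2; case: r => r1 r2; case: p => p1 p2 /=.
  set C := cos Theta in c2 *; have sn0 := sT0; set S := sin Theta in sn0 c2 *.
  have e : C ^+ 2 / S ^+ 2 = S^-1 ^+ 2 - 1.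
    by rewrite c2 mulrBl divff ?expf_neq0// mul1r exprVn.
  apply/eqP; rewrite -subr_eq0; apply/eqP.
  (* The two sides differ by a multiple of the relation [e] between cotangent and sine. *)
  transitivity (((r2 - l2) ^+ 2 + (r1 - l1) ^+ 2) / 4 *
      (C ^+ 2 / S ^+ 2 - (S^-1 ^+ 2 - 1))).
    by field.
  by rewrite e subrr mulr0.
by rewrite lerBlDr lerDl pmulr_lge0// invr_gt0.
Qed.

Lemma sqdist_gt0 u v : u <> v -> 0 < sqdist u v.
Proof.
move=> uv; rewrite lt_def; apply/andP; split; last by rewrite addr_ge0 ?sqr_ge0.
apply/eqP => /eqP; rewrite paddr_eq0 ?sqr_ge0// !sqrf_eq0 !subr_eq0.
by case/andP => /eqP e1 /eqP e2; apply: uv; exact: pairE.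
Qed.

(** [power l r] is quadratic in the point, with leading part [- sin Theta] times the squared norm.
    The last term thus measures its strict concavity, that is, the strict convexity of the disc. *)
Lemma power_convex l r u v t : power l r ((1 - t) *: u + t *: v) =
  (1 - t) * power l r u + t * power l r v + sin Theta * (t * (1 - t) * sqdist u v).
Proof.
by rewrite /power /sees /cross /dot /sqdist !scaleE /=; ring.
Qed.

Lemma power_chord l r u v t : 0 <= power l r u -> 0 <= power l r v -> u <> v ->
  0 < t < 1 -> 0 < power l r ((1 - t) *: u + t *: v).
Proof.
move=> pu pv uv /andP[t0 t1]; rewrite power_convex.
have d := sqdist_gt0 uv.
have t1' : 0 < 1 - t by lra.
have := mulr_gt0 sT (mulr_gt0 (mulr_gt0 t0 t1') d).
have := mulr_ge0 (ltW t1') pu; have := mulr_ge0 (ltW t0) pv; lra.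
Qed.

Lemma power_touch q phi l r : left_ray Theta q phi l -> right_ray q phi r ->
  power l r q = 0.
Proof.
move=> [s _ ->] [t _ ->]; rewrite /power ![q + _]addrC !addrK.
by rewrite seesZl sees_dir crossZr cross_dirxx !mulr0.
Qed.

Lemma chord_touch q phi l r : left_ray Theta q phi l -> right_ray q phi r ->
  0 <= cross (l - r) (q - r).
Proof.
move=> [s s0 ->] [t t0 ->].
have -> : q - (q + t *: dir phi) = - (t *: dir phi).
  by rewrite opprD addrA subrr add0r.
have -> : q + s *: dir (phi + Theta) - (q + t *: dir phi) =
    s *: dir (phi + Theta) - t *: dir phi by rewrite opprD addrACA subrr add0r.
rewrite !crossE subrr sin0.
have -> : phi - (phi + Theta) = - Theta by ring.
by rewrite sinN; have := mulr_ge0 s0 (mulr_ge0 t0 (ltW sT)); lra.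
Qed.

Record placed q phi l r s' s : Prop := Placed {
  pl_s' : 0 < s'; pl_s : 0 < s;
  pl_l : l = q + s' *: dir (phi + Theta);
  pl_r : r = q + s *: dir phi }.

Lemma touch_placed (G : {fset R * R}) q phi l r : touch G Theta q phi l r ->
  q \notin G -> exists s' s, placed q phi l r s' s.
Proof.
move=> [lG rG [s' s'0 lE] [s s0 rE]] qG.
have pos (g u : R * R) k : g = q + k *: u -> g \in G -> 0 <= k -> 0 < k.
  move=> gE gG k0; rewrite lt_def k0 andbT; apply/eqP => k00.
  by move: qG; rewrite -(addr0 q) -(scale0r u) -k00 -gE gG.
by exists s', s; split => //; [exact: pos lE lG s'0|exact: pos rE rG s0].
Qed.

Lemma turn_equation q1 q2 x1 x2 l1 r1 l2 r2 s1' s1 s2' s2 a b z (w : R) :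
  placed q1 x1 l1 r1 s1' s1 -> placed q2 x2 l2 r2 s2' s2 ->
  l2 - l1 = a *: dir (x1 + Theta) + b *: dir (x2 + Theta) ->
  r1 - r2 = z *: dir x1 + w *: dir x2 ->
  [/\ r1 - q2 = z *: dir x1 + (w + s2) *: dir x2,
      l1 - q2 = (s2' - b) *: dir (x2 + Theta) - a *: dir (x1 + Theta)
    & s1 *: dir x1 - s1' *: dir (x1 + Theta) = (r1 - q2) - (l1 - q2)].
Proof.
move=> [_ _ l1E r1E] [_ _ l2E r2E] hl hr.
split.
- rewrite -(subrK r2 r1) hr r2E scalerDl; apply: pairE => /=; ring.
- have -> : l1 = l2 - (l2 - l1) by rewrite opprB addrC subrK.
  rewrite hl l2E scalerBl; apply: pairE => /=; ring.
rewrite l1E r1E; apply: pairE => /=; ring.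
Qed.

(** Seen from the later apex [q2], the old guards are [r1 - q2], a nonnegative combination of
    [dir x1] and [dir x2], and [l1 - q2], a combination of the two left directions. Once [s2' - b]
    is known to be nonnegative, every term of [sees] in the expansion of the power is
    nonnegative. *)
Lemma segment_later q1 q2 x1 x2 l1 r1 l2 r2 s1' s1 s2' s2 :
  placed q1 x1 l1 r1 s1' s1 -> placed q2 x2 l2 r2 s2' s2 ->
  between (x1 + Theta) (x2 + Theta) (l2 - l1) -> between x1 x2 (r1 - r2) ->
  x1 < x2 < x1 + pi - Theta ->
  0 <= power l1 r1 q2 /\ 0 <= cross (l1 - r1) (q2 - r1).
Proof.
move=> p1 p2 [a [b [a0 b0 hl]]] [z [w [z0 w0 hr]]] xE.
have [uE vE e] := turn_equation p1 p2 hl hr.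
have sd : 0 < sin (x2 - x1) by apply: sin_gt0_pi'; tlra.
have sdT : 0 < sin (x2 + Theta - x1) by apply: sin_gt0_pi'; tlra.
have s1p := pl_s p1; have s1p' := pl_s' p1; have s2p := pl_s p2.
have ws : 0 < w + s2 by lra.
(* Take the cross product of [dir x1] with [e]: the left side is negative, and with [s2' - b < 0]
   the right side would be positive. *)
have sbp : 0 <= s2' - b.
  rewrite leNgt; apply/negP => sb.
  have := congr1 (cross (dir x1)) e.
  rewrite uE vE !crossE !subrr sin0.
  have -> : x1 + Theta - x1 = Theta by ring.
  have := mulr_gt0 s1p' sT; have := mulr_gt0 ws sd.
  have sb' : 0 < - (s2' - b) by lra.
  by have := mulr_gt0 sb' sdT; have := mulr_ge0 a0 (ltW sT); lra.
split.
  rewrite /power uE seesDl !seesZl !sees_dir vE !crossE !subrr sin0.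
  have -> : x2 + Theta - (x1 + Theta) = x2 - x1 by ring.
  have -> : x1 + Theta - (x2 + Theta) = - (x2 - x1) by ring.
  rewrite sinN; have := mulr_ge0 (mulr_ge0 z0 sbp) (ltW sd).
  by have := mulr_ge0 (mulr_ge0 (ltW ws) a0) (ltW sd); lra.
have lrE : l1 - r1 = - (s1 *: dir x1 - s1' *: dir (x1 + Theta)).
  by rewrite (pl_l p1) (pl_r p1); apply: pairE => /=; ring.
have qrE : q2 - r1 = - (z *: dir x1 + (w + s2) *: dir x2).
  by rewrite -uE opprB.
rewrite qrE lrE crossNr crossNl opprK.
set v := s1 *: dir x1 - s1' *: dir (x1 + Theta).
have v1 : 0 < cross v (dir x1).
  rewrite /v !crossE subrr sin0; have -> : x1 - (x1 + Theta) = - Theta by ring.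
  by rewrite sinN; have := mulr_gt0 s1p' sT; lra.
have vT : 0 < cross v (dir (x2 + Theta)).
  rewrite /v e uE vE !crossE !subrr sin0.
  have -> : x2 + Theta - (x1 + Theta) = x2 - x1 by ring.
  have -> : x2 + Theta - x2 = Theta by ring.
  have := mulr_ge0 z0 (ltW sdT); have := mulr_gt0 ws sT.
  by have := mulr_ge0 a0 (ltW sd); lra.
(* [dir x2] lies between [dir x1] and [dir (x2 + Theta)], where the sign is known. *)
have v2 : 0 < cross v (dir x2).
  rewrite -(pmulr_rgt0 _ sdT) -crossZr dir_combination crossDr !crossZr.
  have -> : x2 + Theta - x2 = Theta by ring.
  by have := mulr_gt0 sT v1; have := mulr_gt0 sd vT; lra.
rewrite crossDr !crossZr; have := mulr_ge0 z0 (ltW v1).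
by have := mulr_gt0 ws v2; lra.
Qed.

Lemma placed_mirror q phi l r s' s : placed q phi l r s' s ->
  placed (mirror q) (- phi - Theta) (mirror r) (mirror l) s s'.
Proof.
move=> [s'0 s0 -> ->]; split=> //; rewrite mirrorD mirrorZ mirror_dir.
  by rewrite subrK.
by rewrite opprD.
Qed.

Lemma power_mirror l r p : power (mirror r) (mirror l) (mirror p) = power l r p.
Proof. by rewrite /power -!mirrorB sees_mirror. Qed.

(** The mirror image of [segment_later], with the two moments exchanged. *)
Lemma segment_earlier q1 q2 x1 x2 l1 r1 l2 r2 s1' s1 s2' s2 :
  placed q1 x1 l1 r1 s1' s1 -> placed q2 x2 l2 r2 s2' s2 ->
  between (x1 + Theta) (x2 + Theta) (l2 - l1) -> between x1 x2 (r1 - r2) ->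
  x1 < x2 < x1 + pi - Theta ->
  0 <= power l2 r2 q1 /\ 0 <= cross (l2 - r2) (q1 - r2).
Proof.
move=> p1 p2 /between_mirror bl /between_mirror br hx.
have := @segment_later _ _ _ _ _ _ _ _ _ _ _ _ (placed_mirror p2) (placed_mirror p1).
rewrite !subrK !power_mirror -!mirrorB cross_mirror.
have -> : - x2 - Theta = - (x2 + Theta) by ring.
have -> : - x1 - Theta = - (x1 + Theta) by ring.
move=> /(_ br bl) [|-> h]; first lra; split => //; apply: le_trans h _.
by rewrite /cross /=; lra.
Qed.

End Segments.

(** * Continuity on a closed interval *)

Section WithinInterval.
Context {R : realType}.
Implicit Types (a b x c : R) (h : R -> R) (q : R -> R * R) (g u v : R * R).

Lemma within_near_pos a b h x : {within `[a, b], continuous h} -> a <= x <= b ->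
  0 < h x -> exists2 e, 0 < e & forall y, a <= y <= b -> `|y - x| < e -> 0 < h y.
Proof.
move=> /subspace_continuousP ch hx h0.
have hx' : `[a, b]%classic x by rewrite /= in_itv.
have : \forall y \near x, `[a, b]%classic y -> 0 < h y.
  exact: (cvgr_gt _ (ch x hx') _ h0).
move=> /nbhs_ballP[e /= e0 he]; exists e => // y hy yx.
by apply: (he y); [rewrite /ball/= distrC|rewrite /= in_itv /=].
Qed.

Lemma within_comp (U : topologicalType) (f : R * R -> U) a b q :
  {within `[a, b], continuous q} -> continuous f ->
  {within `[a, b], continuous (f \o q)}.
Proof.
move=> /subspace_continuousP cq cf; apply/subspace_continuousP => x hx.
exact: (cvg_comp _ _ (cq x hx) (cf (q x))).
Qed.

Lemma within_fst_snd a b q : {within `[a, b], continuous q} ->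
  {within `[a, b], continuous (fun x => (q x).1)} /\
  {within `[a, b], continuous (fun x => (q x).2)}.
Proof.
move=> cq; split.
  by apply: (@within_comp _ fst _ _ _ cq) => -[u v]; exact: cvg_fst.
by apply: (@within_comp _ snd _ _ _ cq) => -[u v]; exact: cvg_snd.
Qed.

Lemma within_cross_dir a b q c g : {within `[a, b], continuous q} ->
  {within `[a, b], continuous (fun x => cross (dir (x + c)) (g - q x))} /\
  {within `[a, b], continuous (fun x => dot (dir (x + c)) (g - q x))}.
Proof.
move=> /within_fst_snd[c1 c2].
have sh (x : R) : (fun y : R => y + c) @ x --> x + c.
  by apply: cvgD; [exact: cvg_id|exact: cvg_cst].
have cc : {within `[a, b], continuous (fun x => cos (x + c))}.
  apply: continuous_subspaceT => x; apply: (cvg_comp _ _ (sh x)).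
  exact: continuous_cos.
have cs : {within `[a, b], continuous (fun x => sin (x + c))}.
  apply: continuous_subspaceT => x; apply: (cvg_comp _ _ (sh x)).
  exact: continuous_sin.
move/subspace_continuousP : cc => cc; move/subspace_continuousP : cs => cs.
move/subspace_continuousP : c1 => c1; move/subspace_continuousP : c2 => c2.
have d1 x (hx : `[a, b]%classic x) := @cvgB _ _ _ _ _ _ _ _ _ (cvg_cst g.1) (c1 x hx).
have d2 x (hx : `[a, b]%classic x) := @cvgB _ _ _ _ _ _ _ _ _ (cvg_cst g.2) (c2 x hx).
split; apply/subspace_continuousP => x hx; rewrite /cross /dot /dir /=.
  apply: cvgB; apply: cvgM; [exact: cc|exact: d2|exact: cs|exact: d1].
apply: cvgD; apply: cvgM; [exact: cc|exact: d1|exact: cs|exact: d2].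
Qed.

Lemma within_closure a b h x : a < b -> {within `[a, b], continuous h} ->
  (forall y, a < y < b -> 0 <= h y) -> a <= x <= b -> 0 <= h x.
Proof.
move=> ab ch hp hx; rewrite leNgt; apply/negP => hx0.
have ch' : {within `[a, b], continuous (fun y => - h y)}.
  move/subspace_continuousP : ch => ch; apply/subspace_continuousP => y hy.
  exact: (@cvgN _ _ _ _ _ _ _ (ch y hy)).
have [|e e0 he] := within_near_pos ch' hx; first by lra.
(* Moving [x] towards the midpoint by less than [e] gives an interior point [y], even if [x] is an
   end. *)
pose m := (a + b) / 2.
pose t := Num.min 1 (e / 2 / (b - a)).
have t0 : 0 < t by rewrite lt_min ltr01 !divr_gt0//; lra.
have t1 : t <= 1 by rewrite ge_min lexx.
have te : t * (b - a) <= e / 2.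
  rewrite -ler_pdivlMr; last by lra.
  by rewrite ge_min lexx orbT.
pose y := x + t * (m - x).
have yE : y = (1 - t) * x + t * m by rewrite /y; ring.
have amb : a < m < b by rewrite /m; lra.
have xb : 0 <= (1 - t) * (x - a) by apply: mulr_ge0; lra.
have xb2 : 0 <= (1 - t) * (b - x) by apply: mulr_ge0; lra.
have mb : 0 < t * (m - a) by apply: mulr_gt0; lra.
have mb2 : 0 < t * (b - m) by apply: mulr_gt0; lra.
have hy : a < y < b by rewrite yE; lra.
have := he y (ltac:(lra)); have := hp y hy => hy0.
suff : `|y - x| < e by move=> yx /(_ yx); lra.
rewrite /y addrC addKr normrM gtr0_norm//.
apply: le_lt_trans (_ : t * (b - a) < e); last by lra.
by apply: ler_wpM2l; [exact: ltW|rewrite ler_norml; lra].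
Qed.

End WithinInterval.

(** * Position of the path of a complete motion *)

Section CompleteMotion.
Context {R : realType}.
Variables (G : {fset R * R}) (Theta a b : R) (q : R -> R * R).
Hypothesis hT : 0 < Theta < pi.
Hypothesis co : complete G Theta a b q.
Implicit Types (p l r g u v : R * R) (x y s t : R).

Ltac tlra := have /andP[? ?] := hT; lra.

Let ab : a < b. Proof. exact: mo_lt (co_motion co). Qed.
Let cq : {within `[a, b], continuous q}. Proof. exact: mo_cont (co_motion co). Qed.
Let fq x : a < x < b -> q x \notin G. Proof. exact: mo_free (co_motion co) x. Qed.

Let range : b - a <= pi - Theta. Proof. exact: co_range co. Qed.

Lemma complete_segment_open x y l r : a < x < b -> a < y < b ->
  touch G Theta (q x) x l r ->
  0 <= power Theta l r (q y) /\ 0 <= cross (l - r) (q y - r).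
Proof.
move=> hx hy tx.
have [lG rG lx rx] := tx.
have [l2 [r2 ty]] := mo_touch (co_motion co) (ltac:(lra) : a <= y <= b).
have [s1' [s1 p1]] := touch_placed tx (fq hx).
have [s2' [s2 p2]] := touch_placed ty (fq hy).
have [xy|yx|yx] := ltgtP x y.
- have [bl br] := mo_monot (co_motion co) (ltac:(lra) : a <= x) xy (ltac:(lra) : y <= b)
    tx ty (fq hx) (fq hy).
  by apply: (segment_later hT p1 p2 bl br); have := range; lra.
- have [bl br] := mo_monot (co_motion co) (ltac:(lra) : a <= y) yx (ltac:(lra) : x <= b)
    ty tx (fq hy) (fq hx).
  by apply: (segment_earlier hT p2 p1 bl br); have := range; lra.
rewrite -yx; split; last exact: (chord_touch hT lx rx).
by rewrite (power_touch lx rx).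
Qed.

Lemma continuous_power l r : {within `[a, b], continuous (fun x => power Theta l r (q x))}.
Proof.
have [c1 c2] := within_fst_snd cq.
move/subspace_continuousP : c1 => c1; move/subspace_continuousP : c2 => c2.
have d1 u x (hx : `[a, b]%classic x) := @cvgB _ _ _ _ _ _ _ _ _ (cvg_cst u.1) (c1 x hx).
have d2 u x (hx : `[a, b]%classic x) := @cvgB _ _ _ _ _ _ _ _ _ (cvg_cst u.2) (c2 x hx).
apply/subspace_continuousP => x hx; rewrite /power /sees /cross /dot /=.
apply: cvgB; (apply: cvgM; first exact: cvg_cst).
  apply: cvgB; apply: cvgM; [exact: d1|exact: d2|exact: d2|exact: d1].
apply: cvgD; apply: cvgM; [exact: d1|exact: d1|exact: d2|exact: d2].
Qed.

Lemma continuous_chord u v : {within `[a, b], continuous (fun x => cross u (q x - v))}.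
Proof.
have [c1 c2] := within_fst_snd cq.
move/subspace_continuousP : c1 => c1; move/subspace_continuousP : c2 => c2.
have d1 x (hx : `[a, b]%classic x) := @cvgB _ _ _ _ _ _ _ _ _ (c1 x hx) (cvg_cst v.1).
have d2 x (hx : `[a, b]%classic x) := @cvgB _ _ _ _ _ _ _ _ _ (c2 x hx) (cvg_cst v.2).
apply/subspace_continuousP => x hx; rewrite /cross /=.
apply: cvgB; (apply: cvgM; first exact: cvg_cst); [exact: d2|exact: d1].
Qed.

Lemma complete_segment x y l r : a < x < b -> a <= y <= b ->
  touch G Theta (q x) x l r ->
  0 <= power Theta l r (q y) /\ 0 <= cross (l - r) (q y - r).
Proof.
move=> hx hy tx; split.
  apply: (@within_closure _ _ _ _ y ab (@continuous_power l r)) => // z hz.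
  by case: (complete_segment_open hx hz tx).
apply: (@within_closure _ _ _ _ y ab (@continuous_chord (l - r) r)) => // z hz.
by case: (complete_segment_open hx hz tx).
Qed.

(** If the ends coincided, [s *: dir a], which leads from [q a] to the first right guard, would be a
    nonnegative combination of [dir x1], [dir x2] and [dir b]. All of these are strictly
    counterclockwise of [dir a] by less than [pi], so all coefficients vanish, and with them [s]. *)
Lemma complete_ends_neq : q a <> q b.
Proof.
move=> e.
have [l [r [[t ht tch] qar]]] := co_start co.
have [l' [r' [[t' ht' tch'] _]]] := co_end co.
(* The moments [x1 < x2] are interior, inside the initial and the final interval of touching. *)
pose x1 := (a + Num.min t ((a + b) / 2)) / 2.
have hx1 : a < x1 < t /\ x1 < b.
  have h : a < Num.min t ((a + b) / 2) by rewrite lt_min; have := ab; lra.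
  have h' : Num.min t ((a + b) / 2) <= t by rewrite ge_min lexx.
  by rewrite /x1; lra.
pose x2 := (b + Num.max t' x1) / 2.
have hx2 : [/\ t' < x2, x1 < x2 & x2 < b].
  have h : Num.max t' x1 < b by rewrite gt_max; lra.
  have h' : t' <= Num.max t' x1 by rewrite le_max lexx.
  have h'' : x1 <= Num.max t' x1 by rewrite le_max lexx orbT.
  by rewrite /x2; split; lra.
case: hx2 => x2t' x12 x2b.
have i1 : a < x1 < b by lra.
have i2 : a < x2 < b by lra.
have j1 : a <= x1 <= t by lra.
have j2 : t' <= x2 <= b by lra.
have ax1 : a <= x1 by lra.
have x2b' : x2 <= b by lra.
have [_ [z [w [z0 w0 hr]]]] := mo_monot (co_motion co) ax1 x12 x2b'
  (tch x1 j1) (tch' x2 j2) (fq i1) (fq i2).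
have [_ _ _ [s s0 rE]] := tch a (ltac:(lra)).
have [_ _ _ [s' s'0 rE']] := tch' b (ltac:(lra)).
have sp : 0 < s.
  rewrite lt_def s0 andbT; apply/eqP => z00; apply: qar.
  by rewrite rE z00 scale0r addr0.
have e1 : s *: dir a = z *: dir x1 + w *: dir x2 + s' *: dir b.
  by rewrite -hr {1}rE rE' e; apply: pairE => /=; ring.
have := congr1 (cross (dir a)) e1; rewrite !crossE subrr sin0 mulr0.
have rg := range.
have n1 : 0 < sin (x1 - a) by apply: sin_gt0_pi'; tlra.
have n2 : 0 < sin (x2 - a) by apply: sin_gt0_pi'; tlra.
have n3 : 0 < sin (b - a) by apply: sin_gt0_pi'; tlra.
have m1 := mulr_ge0 z0 (ltW n1); have m2 := mulr_ge0 w0 (ltW n2).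
have m3 := mulr_ge0 s'0 (ltW n3) => e0.
have z1 : z = 0.
  have /eqP : z * sin (x1 - a) = 0 by lra.
  by rewrite mulf_eq0 (gt_eqF n1) orbF => /eqP.
have w1 : w = 0.
  have /eqP : w * sin (x2 - a) = 0 by lra.
  by rewrite mulf_eq0 (gt_eqF n2) orbF => /eqP.
have s1 : s' = 0.
  have /eqP : s' * sin (b - a) = 0 by lra.
  by rewrite mulf_eq0 (gt_eqF n3) orbF => /eqP.
move: e1; rewrite z1 w1 s1 !scale0r !addr0 => /eqP.
by rewrite scale_eq0_dir => /eqP sz; rewrite sz ltxx in sp.
Qed.

Let line_point u v p : u <> v -> cross (v - u) (p - u) = 0 ->
  exists t, p = (1 - t) *: u + t *: v.
Proof.
move=> uv h.
have d := sqdist_gt0 uv.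
exists (dot (v - u) (p - u) / sqdist u v).
move: h d; rewrite /sqdist /cross /dot; case: u uv => u1 u2 _; case: v => v1 v2.
case: p => p1 p2 /= h d; rewrite !scaleE /=.
set D := _ + _ in d *.
have dn : D != 0 by rewrite gt_eqF.
apply: pairE => /=; apply: (mulfI dn).
  transitivity (D * u1 + ((v1 - u1) * (p1 - u1) + (v2 - u2) * (p2 - u2)) * (v1 - u1));
    last by field.
  transitivity (D * u1 + ((v1 - u1) * (p1 - u1) + (v2 - u2) * (p2 - u2)) * (v1 - u1)
    - (v2 - u2) * ((v1 - u1) * (p2 - u2) - (v2 - u2) * (p1 - u1))).
    by rewrite /D; ring.
  by rewrite h mulr0 subr0.
transitivity (D * u2 + ((v1 - u1) * (p1 - u1) + (v2 - u2) * (p2 - u2)) * (v2 - u2));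
  last by field.
transitivity (D * u2 + ((v1 - u1) * (p1 - u1) + (v2 - u2) * (p2 - u2)) * (v2 - u2)
  + (v1 - u1) * ((v1 - u1) * (p2 - u2) - (v2 - u2) * (p1 - u1))).
  by rewrite /D; ring.
by rewrite h mulr0 addr0.
Qed.

(** Of three distinct collinear points [q a], [q x], [q b], one lies strictly between the others.
    But all three lie in a disc that has the middle one on its circle, which strict convexity
    forbids. *)
Lemma complete_off_chord x : a < x < b -> cross (q b - q a) (q x - q a) != 0.
Proof.
move=> hx; apply/eqP => h.
have [t e] := line_point complete_ends_neq h.
have [qaG qbG] := co_guards co.
have ha : a <= a <= b by have := ab; lra.
have hb : a <= b <= b by have := ab; lra.
have hx' : a <= x <= b by lra.
have xa : q x <> q a by move=> e'; have := fq hx; rewrite e' qaG.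
have xb : q x <> q b by move=> e'; have := fq hx; rewrite e' qbG.
have inner (c y y1 y2 t0 : R) l r : a < c < b -> touch G Theta (q c) c l r ->
    touch G Theta (q y) y l r -> a <= y1 <= b -> a <= y2 <= b -> q y1 <> q y2 ->
    q y = (1 - t0) *: q y1 + t0 *: q y2 -> 0 < t0 < 1 -> False.
  move=> hc tc [_ _ ly ry] h1 h2 n12 yE ht0.
  have [p1 _] := complete_segment hc h1 tc; have [p2 _] := complete_segment hc h2 tc.
  have := power_chord hT p1 p2 n12 ht0; rewrite -yE (power_touch ly ry).
  by rewrite ltxx.
(* Here [q a] is the middle point, at parameter [- t / (1 - t)] from [q x] to [q b]; the pair
   touched at the start provides the disc. *)
have [t0|t0] := ltrP t 0.
  have [l [r [[c hc tch] _]]] := co_start co.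
  have hm : a < (a + c) / 2 < b by have := ab; lra.
  apply: (inner _ a x b (- t / (1 - t)) l r hm) => //.
  - by apply: tch; lra.
  - by apply: tch; lra.
  - have n : 1 - t != 0 by rewrite gt_eqF//; lra.
    rewrite e scalerDr !scalerA -addrA -scalerDl.
    have -> : (1 - - t / (1 - t)) * (1 - t) = 1 by field.
    have -> : (1 - - t / (1 - t)) * t + - t / (1 - t) = 0 by field.
    by rewrite scale1r scale0r addr0.
  - rewrite divr_gt0//=; try lra.
    by rewrite ltr_pdivrMr; lra.
have [t1|t1] := ltrP 1 t.
  have [l [r [[c hc tch] _]]] := co_end co.
  have hm : a < (c + b) / 2 < b by have := ab; lra.
  apply: (inner _ b a x t^-1 l r hm) => //.
  - by apply: tch; lra.
  - by apply: tch; lra.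
  - by move=> e'; exact: xa.
  - have n : t != 0 by rewrite gt_eqF//; lra.
    rewrite e scalerDr !scalerA addrA -scalerDl.
    have -> : 1 - t^-1 + t^-1 * (1 - t) = 0 by field.
    by rewrite mulVf// scale1r scale0r add0r.
  - by rewrite invr_gt0 invf_lt1; lra.
have [tz|tn] := eqVneq t 0.
  by apply: xa; rewrite e tz subr0 scale1r scale0r addr0.
have [tz|tn'] := eqVneq t 1.
  by apply: xb; rewrite e tz subrr scale1r scale0r add0r.
have [l [r tx]] := mo_touch (co_motion co) hx'.
apply: (inner x x a b t l r) => //; first exact: complete_ends_neq.
by rewrite lt_neqAle eq_sym tn t0 lt_neqAle tn' t1.
Qed.

End CompleteMotion.

(** * Maximal intervals of touching *)

Section TouchClosed.
Context {R : realType}.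
Variables (G : {fset R * R}) (Theta a b : R) (q : R -> R * R).
Hypothesis cq : {within `[a, b], continuous q}.
Implicit Types (p l r g u v : R * R) (x y s t c : R).

Lemma within_opp (h : R -> R) : {within `[a, b], continuous h} ->
  {within `[a, b], continuous (fun x => - h x)}.
Proof.
move=> /subspace_continuousP ch; apply/subspace_continuousP => y hy.
exact: (@cvgN _ _ _ _ _ _ _ (ch y hy)).
Qed.

Lemma ray_away x c g : a <= x <= b -> ~ ray (q x) (x + c) g ->
  exists2 e, 0 < e &
    forall y, a <= y <= b -> `|y - x| < e -> ~ ray (q y) (y + c) g.
Proof.
move=> hx nr; have [cc cd] := within_cross_dir c g cq.
have [c0|c0|c0] := ltgtP (cross (dir (x + c)) (g - q x)) 0.
- have [|e e0 he] := within_near_pos (within_opp cc) hx; first by rewrite oppr_gt0.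
  by exists e => // y hy yx /rayP[k _]; have := he y hy yx; rewrite k oppr0 ltxx.
- have [|e e0 he] := within_near_pos cc hx; first by [].
  by exists e => // y hy yx /rayP[k _]; have := he y hy yx; rewrite k ltxx.
have d0 : dot (dir (x + c)) (g - q x) < 0.
  by rewrite ltNge; apply/negP => d0; apply: nr; apply/rayP.
have [|e e0 he] := within_near_pos (within_opp cd) hx; first by rewrite oppr_gt0.
exists e => // y hy yx /rayP[_ k]; have := he y hy yx.
by rewrite oppr_gt0 ltNge k.
Qed.

Lemma touch_away x l r : a <= x <= b -> ~ touch G Theta (q x) x l r ->
  exists2 e, 0 < e &
    forall y, a <= y <= b -> `|y - x| < e -> ~ touch G Theta (q y) y l r.
Proof.
move=> hx nt.
have [lG|lG] := boolP (l \in G); last first.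
  by exists 1 => // y _ _ [k _ _ _]; rewrite k in lG.
have [rG|rG] := boolP (r \in G); last first.
  by exists 1 => // y _ _ [_ k _ _]; rewrite k in rG.
have [lx|nlx] := pselect (left_ray Theta (q x) x l); last first.
  have [e e0 he] := @ray_away x Theta l hx nlx.
  by exists e => // y hy yx [_ _ k _]; exact: (he y hy yx k).
have [rx|nrx] := pselect (right_ray (q x) x r); first by case: nt.
have [|e e0 he] := @ray_away x 0 r hx; first by rewrite addr0.
exists e => // y hy yx [_ _ _ k]; apply: (he y hy yx); by rewrite addr0.
Qed.

Lemma bounded_touch_closedr s t l r : a <= s -> s < t -> t <= b ->
  (forall x, s <= x < t -> touch G Theta (q x) x l r) ->
  bounded_touch G Theta s t q l r.
Proof.
move=> as_ st tb h x hx; have [->|xt] := eqVneq x t; last first.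
  by apply: h; rewrite lt_neqAle xt; case/andP: hx => -> ->.
apply: contrapT => nt; have [|e e0 he] := @touch_away t l r _ nt; first by lra.
pose y := Num.max s (t - e / 2).
have y1 : s <= y < t by rewrite le_max lexx /= gt_max; lra.
have y2 : t - e / 2 <= y by rewrite le_max lexx orbT.
apply: (he y); [lra| |exact: h].
by rewrite ler0_norm; lra.
Qed.

Lemma bounded_touch_closedl s t l r : a <= s -> s < t -> t <= b ->
  (forall x, s < x <= t -> touch G Theta (q x) x l r) ->
  bounded_touch G Theta s t q l r.
Proof.
move=> as_ st tb h x hx; have [->|xs] := eqVneq x s; last first.
  by apply: h; rewrite lt_neqAle eq_sym xs; case/andP: hx => -> ->.
apply: contrapT => nt; have [|e e0 he] := @touch_away s l r _ nt; first by lra.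
pose y := Num.min t (s + e / 2).
have y1 : s < y <= t by rewrite lt_min ge_min lexx /=; lra.
have y2 : y <= s + e / 2 by rewrite ge_min lexx orbT.
apply: (he y); [lra| |exact: h].
by rewrite ger0_norm; lra.
Qed.

(** The two ends can be extended independently, since every interval in question contains
    [[s0, t0]]. The extrema are attained because touching is a closed condition. *)
Lemma maximal_touch s0 t0 l r : a <= s0 -> s0 < t0 -> t0 <= b ->
  bounded_touch G Theta s0 t0 q l r ->
  exists s t, [/\ a <= s <= s0, t0 <= t <= b, bounded_touch G Theta s t q l r
    & forall s' t', a <= s' <= s -> t <= t' <= b ->
        bounded_touch G Theta s' t' q l r -> s' = s /\ t' = t].
Proof.
move=> as0 st0 t0b h0.
pose T := [set t | t0 <= t <= b /\ bounded_touch G Theta s0 t q l r].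
pose S := [set s | a <= s <= s0 /\ bounded_touch G Theta s t0 q l r].
have hT : has_sup T.
  by split; [exists t0; split; rewrite ?lexx|exists b => x [/andP[]]].
have hS : has_inf S.
  by split; [exists s0; split; rewrite ?lexx ?as0|exists a => x [/andP[]]].
pose t := sup T; pose s := inf S.
have t0t : t0 <= t by apply: ub_le_sup; [exact: hT.2|split; rewrite ?lexx].
have tb : t <= b by apply: ge_sup; [exact: hT.1|move=> x [/andP[]]].
have ss0 : s <= s0 by apply: ge_inf; [exact: hS.2|split; rewrite ?lexx ?as0].
have sa : a <= s by apply: lb_le_inf; [exact: hS.1|move=> x [/andP[]]].
have bt : bounded_touch G Theta s0 t q l r.
  apply: bounded_touch_closedr => //; first by lra.
  move=> x hx; have [|t' [ht' tch'] t'x] := @sup_adherent _ T (t - x) _ hT; first by lra.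
  by apply: tch'; move: t'x; rewrite -/t; lra.
have bs : bounded_touch G Theta s t0 q l r.
  apply: bounded_touch_closedl => //; first by lra.
  move=> x hx; have [|t' [ht' tch'] t'x] := @inf_adherent _ S (x - s) _ hS; first by lra.
  by apply: tch'; move: t'x; rewrite -/s; lra.
exists s, t; split; [by rewrite sa|by rewrite t0t| |].
  move=> x hx; have [xs|xs] := lerP x t0; first by apply: bs; lra.
  by apply: bt; lra.
move=> s' t' hs' ht' h'; split.
  have : s <= s'.
    apply: ge_inf; first exact: hS.2.
    by split; [lra|move=> x hx; apply: h'; lra].
  by lra.
have : t' <= t.
  apply: ub_le_sup; first exact: hT.2.
  by split; [lra|move=> x hx; apply: h'; lra].
by lra.
Qed.

End TouchClosed.

(** * Tunnels and their arcs *)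

Section Tunnel.
Context {R : realType}.
Variables (G : {fset R * R}) (Theta a b : R) (q : R -> R * R).
Hypothesis hT : 0 < Theta < pi.
Hypothesis co : complete G Theta a b q.
Implicit Types (p l r g u v : R * R) (x y s t c : R).

Let sT : 0 < sin Theta. Proof. exact: sin_gt0_pi. Qed.
Let ab : a < b. Proof. exact: mo_lt (co_motion co). Qed.
Let cq : {within `[a, b], continuous q}. Proof. exact: mo_cont (co_motion co). Qed.

Lemma complete_tunnel : is_tunnel G Theta (Sweep a b q).
Proof.
split => //=.
- move=> x hx; split; first exact: mo_empty (co_motion co) x hx.
  exact: mo_touch (co_motion co) x hx.
- exact: mo_free (co_motion co).
have [qa qb] := co_guards co; split => //.
by apply/eqP; rewrite /sw_l0 /sw_r0 /=; exact: (complete_ends_neq hT co).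
Qed.

(** The inner part of the path avoids the line through its ends, so by the intermediate value
    theorem it stays on one side. *)
Lemma complete_halfplane : exists h, tunnel_halfplane (Sweep a b q) h.
Proof.
pose f x := cross (q b - q a) (q x - q a).
have cf : {within `[a, b], continuous f} := @continuous_chord _ _ _ _ _ _ co _ _.
pose m := (a + b) / 2.
have hm : a < m < b by rewrite /m; have := ab; lra.
have f0 x : a < x < b -> f x != 0 := @complete_off_chord _ _ _ _ _ _ hT co x.
have sign x : a < x < b -> 0 < f m * f x.
  move=> hx; rewrite lt_def mulf_neq0 ?f0//= leNgt; apply/negP => neg.
  have zero c d : c <= d -> a < c -> d < b ->
      Num.min (f c) (f d) <= 0 <= Num.max (f c) (f d) -> False.
    move=> cd ac db h.
    have [|y] := @IVT R f c d 0 cd _ h.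
      apply: continuous_subspaceW cf => y /=; rewrite !in_itv /=; lra.
    rewrite in_itv /= => hy fy; have := @f0 y (ltac:(lra)).
    by rewrite fy eqxx.
  have minmax (u v : R) : u * v < 0 -> Num.min u v <= 0 <= Num.max u v.
    move=> uv; have [u0|u0] := lerP u 0; have [v0|v0] := lerP v 0.
    - by have := mulr_le0 u0 v0; lra.
    - by rewrite ge_min u0 le_max (ltW v0) orbT.
    - by rewrite ge_min v0 orbT le_max (ltW u0).
    - by have := mulr_gt0 u0 v0; lra.
  have [xm|xm] := lerP x m.
    by apply: (zero x m xm) => //; [lra|lra|apply: minmax; rewrite mulrC].
  by apply: (zero m x (ltW xm)) => //; [lra|lra|exact: minmax].
have fab x : a <= x <= b -> 0 <= f m * f x.
  move=> hx.
  have [->|xa] := eqVneq x a; first by rewrite {2}/f subrr cross0r mulr0.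
  have [->|xb] := eqVneq x b.
    have -> : f b = 0 by rewrite /f /cross [X in _ - X]mulrC subrr.
    by rewrite mulr0.
  apply/ltW/sign; rewrite lt_neqAle eq_sym xa lt_neqAle xb.
  by case/andP: hx => -> ->.
have [fm|fm] := ltrP 0 (f m).
  exists (left_halfplane (q a) (q b)); split; first by left.
  by move=> p [x /= hx <-]; have := fab x hx; rewrite pmulr_rge0.
exists (left_halfplane (q b) (q a)); split; first by right.
move=> p [x /= hx <-]; rewrite /left_halfplane /=.
have fm' : f m < 0 by rewrite lt_neqAle f0.
have := fab x hx; rewrite nmulr_rge0// /f => k.
have -> : cross (q a - q b) (q x - q b) = - cross (q b - q a) (q x - q a).
  by rewrite /cross /=; ring.
by rewrite oppr_ge0.
Qed.

(** By strict concavity the powers of [p + d] and [p - d] have a negative sum, so [h] cannot contain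
    a whole neighborhood of [p]. *)
Lemma power_frontier l r p (h : set (R * R)) : power Theta l r p = 0 ->
  h p -> (forall u, h u -> 0 <= power Theta l r u) -> frontier h p.
Proof.
move=> p0 hp hpos; split; first exact: subset_closure.
move=> /nbhs_ballP[e /= e0 he].
pose d : R * R := (e / 2, 0).
have bp : h (p + d).
  by apply: he; split; rewrite /ball /= ltr_norml; lra.
have bm : h (p - d).
  by apply: he; split; rewrite /ball /= ltr_norml; lra.
have := hpos _ bp; have := hpos _ bm.
have key : power Theta l r (p + d) + power Theta l r (p - d) =
    2 * power Theta l r p - 2 * sin Theta * (e / 2) ^+ 2.
  by rewrite /power /sees /cross /dot /d /=; ring.
have : 0 < sin Theta * (e / 2) ^+ 2 by rewrite mulr_gt0// exprn_gt0//; lra.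
by move: key; rewrite p0; lra.
Qed.

Lemma complete_boundary_arc s0 t0 l r : a <= s0 -> s0 < t0 -> t0 <= b ->
  bounded_touch G Theta s0 t0 q l r ->
  exists2 A, boundary_arcs G Theta A & forall x, s0 <= x <= t0 -> A (q x).
Proof.
move=> as0 st0 t0b /(maximal_touch cq as0 st0 t0b) [s [t [hs ht tch mx]]].
have [h hh] := complete_halfplane.
exists (q @` [set x | s <= x <= t]); last first.
  by move=> x hx; exists x => //=; lra.
exists (Sweep a b q), h; split => //; first exact: complete_tunnel.
  exists l, r, s, t; split => /=; [lra|lra|lra|by []|split => //].
  by move=> p [x /= hx <-]; exists x; case: (tch x hx).
have mid : exists2 x, a < x < b & touch G Theta (q x) x l r.
  by exists ((s + t) / 2); [lra|apply: tch; lra].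
have [z hz tz] := mid.
move=> p [x /= hx <-]; apply: (@power_frontier l r).
- by have [_ _ lx rx] := tch x hx; exact: (power_touch lx rx).
- split; last by case: hh => _; apply; exists x => //=; lra.
  move=> -[l' r'] /= [y /= hy ty]; apply/(circular_segmentP hT).
  apply: (complete_segment hT co hy _ ty); lra.
move=> u [/(_ (l, r)) hu _]; have := hu (ex_intro2 _ _ z hz tz).
by move=> /(circular_segmentP hT)[].
Qed.

End Tunnel.

(** * The frontier of the region *)

Section Frontier.
Context {R : realType}.
Variables (G : {fset R * R}) (Theta : R).
Hypothesis hT : 0 < Theta < pi.
Implicit Types (p l r g h u v : R * R) (phi psi x y s t c : R).

Let sT : 0 < sin Theta. Proof. exact: sin_gt0_pi. Qed.

Lemma dir_scale_inj s t x y : 0 < s -> 0 <= t -> s *: dir x = t *: dir y ->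
  s = t /\ dir x = dir y :> R * R.
Proof.
move=> s0 t0 e; have [e1 e2] : s * cos x = t * cos y /\ s * sin x = t * sin y.
  by move: e; rewrite !scaleE => -[].
have st : s = t.
  have : s ^+ 2 = t ^+ 2.
    transitivity ((s * cos x) ^+ 2 + (s * sin x) ^+ 2).
      by rewrite !exprMn -mulrDr dir_norm mulr1.
    by rewrite e1 e2 !exprMn -mulrDr dir_norm mulr1.
  by move=> /eqP; rewrite (eqrXn2 _ (ltW s0) t0)// => /eqP.
split=> //; have := e; rewrite st => /scalerI; apply.
by rewrite -st gt_eqF.
Qed.

(** Reduction modulo [2 * pi], stated as a period of [dir] so that no integer multiple has to be
    named. *)
Lemma dir_mod phi : exists psi, 0 <= psi < 2 * pi /\
  forall x, dir (x + (psi - phi)) = dir x :> R * R.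
Proof.
have [t [psi [t0 hpsi e]]] := polar0 (dir phi).
have [_ e'] := @dir_scale_inj 1 t phi psi ltr01 t0 (ltac:(by rewrite scale1r)).
exists psi; split=> // x; have [c1 c2] : cos phi = cos psi /\ sin phi = sin psi.
  by case: e'.
have cc : cos (psi - phi) = 1 by rewrite cosB -c1 -c2 -!expr2 dir_norm.
have ss : sin (psi - phi) = 0 by rewrite sinB -c1 -c2 mulrC subrr.
by apply: pairE => /=; [rewrite cosD|rewrite sinD]; rewrite cc ss mulr0 mulr1 ?subr0 ?addr0.
Qed.

Definition in_cone p phi g : Prop :=
  0 < cross (dir phi) (g - p) /\ 0 < cross (g - p) (dir (phi + Theta)).

Lemma guardedP p : guarded G Theta p <->
  forall phi, 0 <= phi <= 2 * pi -> exists2 g, g \in G & in_cone p phi g.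
Proof.
split=> h phi.
  move=> _; apply: contrapT => ne; apply: (h phi); apply/(empty_coneP _ hT) => g gG k.
  by apply: ne; exists g.
move=> /(empty_coneP _ hT) em; have [psi [hpsi e]] := dir_mod phi.
have [|g gG [k1 k2]] := h psi; first by lra.
apply: (em g gG); move: k1 k2.
have <- : dir psi = dir phi by rewrite -[RHS]e addrCA subrr addr0.
have <- // : dir (psi + Theta) = dir (phi + Theta).
by rewrite -[RHS]e; congr dir; ring.
Qed.

(** One guard serves for all apices and directions near a given pair. Directions range over a
    compact interval, so one neighborhood of [p] works for all of them. *)
Lemma theta_region_open p : guarded G Theta p ->
  \forall p' \near p, guarded G Theta p'.
Proof.
move=> /guardedP gp.
have := @segment_compact R 0 (2 * pi) => /compact_near_coveringP.
move=> /(_ _ (nbhs p) (fun p' phi => exists2 g, g \in G & in_cone p' phi g) _).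
suff H phi : 0 <= phi <= 2 * pi -> \forall phi' \near phi & p' \near p,
    exists2 g, g \in G & in_cone p' phi' g.
  move=> K; have := K (ltac:(by move=> phi; rewrite /= in_itv /= => hp; apply: H)).
  apply: filterS => p' h; apply/guardedP => phi hp; apply: h.
  by rewrite /= in_itv.
move=> hp; have [g gG [k1 k2]] := gp phi hp.
have c1 : z.1 @[z --> (phi, p)] --> phi by exact: cvg_fst.
have c2 : z.2 @[z --> (phi, p)] --> p by exact: cvg_snd.
have c21 : z.2.1 @[z --> (phi, p)] --> p.1.
  by apply: (cvg_comp _ _ c2); case: (p) => ? ?; exact: cvg_fst.
have c22 : z.2.2 @[z --> (phi, p)] --> p.2.
  by apply: (cvg_comp _ _ c2); case: (p) => ? ?; exact: cvg_snd.
have d1 := @cvgB _ _ _ _ _ _ _ _ _ (cvg_cst g.1) c21.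
have d2 := @cvgB _ _ _ _ _ _ _ _ _ (cvg_cst g.2) c22.
have ct : (z.1 + Theta) @[z --> (phi, p)] --> phi + Theta.
  exact: (@cvgD _ _ _ _ _ _ _ _ _ c1 (cvg_cst Theta)).
have cc c (f : R * (R * R) -> R) (cf : f z @[z --> (phi, p)] --> c) :=
  cvg_comp _ _ cf (@continuous_cos R c).
have cs c (f : R * (R * R) -> R) (cf : f z @[z --> (phi, p)] --> c) :=
  cvg_comp _ _ cf (@continuous_sin R c).
have e1 : cross (dir z.1) (g - z.2) @[z --> (phi, p)] --> cross (dir phi) (g - p).
  by apply: cvgB; apply: cvgM; [exact: cc|exact: d2|exact: cs|exact: d1].
have e2 : cross (g - z.2) (dir (z.1 + Theta)) @[z --> (phi, p)] -->
    cross (g - p) (dir (phi + Theta)).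
  by apply: cvgB; apply: cvgM;
    [exact: d1|exact: (cs _ (fun z => z.1 + Theta) ct)
    |exact: d2|exact: (cc _ (fun z => z.1 + Theta) ct)].
have n1 := cvgr_gt _ e1 _ k1; have n2 := cvgr_gt _ e2 _ k2.
have FF : Filter (nbhs (phi, p)) by exact: nbhs_filter.
have h : \forall z \near (phi, p), exists2 g, g \in G & in_cone z.2 z.1 g.
  apply: (@filterS _ _ FF _ _ _ (@filterI _ _ FF _ _ (n1 FF) (n2 FF))) => z [z1 z2].
  by exists g.
exact: h.
Qed.

(** The cone turns clockwise about [p] until its right ray meets a guard. Angles are taken in the
    full turn that ends at [phi + Theta]; emptiness keeps them at most [phi], and the largest one is
    met first. *)
Lemma rotate_to_guard p phi : empty_cone G Theta p phi ->
  (exists2 g, g \in G & g <> p) ->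
  exists phi', empty_cone G Theta p phi' /\
    exists2 r, r \in G & right_ray p phi' r /\ r <> p.
Proof.
move=> em [g0 g0G g0p].
pose c := phi + Theta - 2 * pi.
have /choice[ang hang] : forall g, exists psi,
    c <= psi < c + 2 * pi /\ exists2 t, 0 <= t & g - p = t *: dir psi.
  by move=> g; have [t [psi [t0 hpsi e]]] := polar (g - p) c; exists psi; split=> //; exists t.
have ang_le g : g \in G -> g <> p -> ang g <= phi.
  move=> gG gp; rewrite leNgt; apply/negP => k; have [hc [t t0 e]] := hang g.
  apply: (em g gG); exists t, (ang g); split; last by rewrite -e addrC subrK.
    rewrite lt_def t0 andbT; apply/eqP => tz; apply: gp; apply/eqP.
    by rewrite -subr_eq0 e tz scale0r.
  by move: hc; rewrite /c k /=; lra.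
have [r [rG rp rmax]] 
  := @fset_argmin R _ G (fun g => g <> p) (fun g => - ang g) (ex_intro2 _ _ g0 g0G g0p).
have [hr [tr tr0 er]] := hang r.
exists (ang r); split; last first.
  by exists r => //; split => //; exists tr => //; rewrite -er addrC subrK.
move=> h hG [t [psi [t0 hpsi e]]].
have hp : h <> p.
  move=> hp; have /eqP : t *: dir psi = 0.
    by apply: (addrI p); rewrite addr0 -e.
  by rewrite scale_eq0_dir => /eqP tz; rewrite tz ltxx in t0.
have [hh [t' t'0 e']] := hang h; have le1 := rmax h hG hp; have le2 := ang_le r rG rp.
have [_ /esym] : t = t' /\ dir psi = dir (ang h) :> R * R.
  by apply: dir_scale_inj => //; rewrite -e' e addrC addKr.
move/dir_inj_2pi => k; move: hh; rewrite /c => hh.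
have : ang h = psi by apply: k; move: hpsi; lra.
by move: hpsi; lra.
Qed.

(** With no guard on the left ray, a slight counterclockwise turn leaves every guard strictly
    outside the closed cone. This persists for all apices near [p], which are then unguarded. *)
Lemma left_guard_of_closure p phi : closure (theta_region G Theta) p ->
  empty_cone G Theta p phi -> exists2 l, l \in G & left_ray Theta p phi l.
Proof.
move=> clp em; apply: contrapT => nl.
have [x _ hx] : exists2 x, phi < x < phi + 1 & forall g, g \in G ->
    cross (dir x) (g - p) < 0 \/ cross (g - p) (dir (x + Theta)) < 0.
  apply: near_right_witness; first by lra.
  apply: filter_fset => g gG.
  have [A|A] := ltrP (cross (dir phi) (g - p)) 0.
    have : 0 < cross (g - p) (dir phi) by rewrite crossC oppr_gt0.
    move=> /(near_right_pos (@continuous_cross_dir0 R (g - p))).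
    by apply: filterS => x hx; left; rewrite crossC oppr_lt0.
  have [B|B] := ltrP (cross (g - p) (dir (phi + Theta))) 0.
    have : 0 < cross (p - g) (dir (phi + Theta)).
      by rewrite -opprB crossNl oppr_gt0.
    move=> /(near_right_pos (@continuous_cross_dir R (p - g) Theta)).
    by apply: filterS => x hx; right; rewrite -opprB crossNl oppr_lt0.
  have [B0|Bn] := eqVneq (cross (g - p) (dir (phi + Theta))) 0.
    exfalso; apply: nl; exists g => //.
    exists (cross (dir phi) (g - p) / sin Theta); first by rewrite divr_ge0// ltW.
    exact: (left_ray_of_cross hT).
  have Bp : 0 < cross (g - p) (dir (phi + Theta)) by rewrite lt_def Bn.
  have A0 : cross (dir phi) (g - p) = 0.
    apply/eqP; apply: contrapT => /negP An.
    move/(empty_coneP _ hT) : em => /(_ g gG); apply; split => //.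
    by rewrite lt_def An.
  have gE := right_ray_of_cross hT A0.
  set k := _ / _ in gE; have k0 : 0 < k by exact: divr_gt0.
  have := sin_near_right phi; apply: filterS => x hx; left.
  rewrite gE addrC addKr crossZr cross_dir -opprB sinN mulrN oppr_lt0.
  exact: mulr_gt0.
have : \forall p' \near p, forall g, g \in G ->
    cross (dir x) (g - p') < 0 \/ cross (g - p') (dir (x + Theta)) < 0.
  have FF : Filter (nbhs p) by exact: nbhs_filter.
  apply: (@filter_fset _ _ _ G (fun g p' => cross (dir x) (g - p') < 0 \/
    cross (g - p') (dir (x + Theta)) < 0) FF) => g gG.
  have c1 : z.1 @[z --> p] --> p.1 by case: (p) => ? ?; exact: cvg_fst.
  have c2 : z.2 @[z --> p] --> p.2 by case: (p) => ? ?; exact: cvg_snd.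
  have d1 := @cvgB _ _ _ _ _ _ _ _ _ (cvg_cst g.1) c1.
  have d2 := @cvgB _ _ _ _ _ _ _ _ _ (cvg_cst g.2) c2.
  have e1 : cross (dir x) (g - z) @[z --> p] --> cross (dir x) (g - p).
    by apply: cvgB; (apply: cvgM; first exact: cvg_cst); [exact: d2|exact: d1].
  have e2 : cross (g - z) (dir (x + Theta)) @[z --> p] -->
      cross (g - p) (dir (x + Theta)).
    by apply: cvgB; (apply: cvgM; last exact: cvg_cst); [exact: d1|exact: d2].
  case: (hx g gG) => k.
    by apply: (@filterS _ _ FF _ _ _ (@cvgr_lt _ _ _ FF _ _ e1 _ k)) => z; left.
  by apply: (@filterS _ _ FF _ _ _ (@cvgr_lt _ _ _ FF _ _ e2 _ k)) => z; right.
move=> /clp[p' [gp' hp']]; apply: (gp' x); apply/(empty_coneP _ hT) => g gG [k1 k2].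
by case: (hp' g gG); lra.
Qed.

Lemma frontier_covered :
  frontier (theta_region G Theta) `<=` \bigcup_(A in boundary_arcs G Theta) A.
Proof.
move=> p [clp nint].
have [phi em] : exists phi, empty_cone G Theta p phi.
  apply: contrapT => ne; apply: nint; apply: theta_region_open => phi em.
  by apply: ne; exists phi.
(* Otherwise a guarded point near [p] would see the single guard [p] in the opposite half planes of
   the directions [0] and [pi]. *)
have other : exists2 g, g \in G & g <> p.
  apply: contrapT => ne.
  have all_p g : g \in G -> g = p.
    by move=> gG; apply: contrapT => gp; apply: ne; exists g.
  have [x [/guardedP gx _]] := clp setT filterT.
  have pi0 := pi_gt0 R.
  have [|g1 /all_p -> [k1 _]] := gx 0; first by lra.
  have [|g2 /all_p -> [k2 _]] := gx pi; first by lra.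
  by move: k2; rewrite -[pi in dir pi]add0r dirDpi crossNl; lra.
have [phi' [em' hr]] := rotate_to_guard em other.
have [pG|pG] := boolP (p \in G).
  have [hi [q [l [r [co qp [t ht tch]]]]]] := complete_from_guard hT pG em' hr.
  have /andP[h1 h2] := ht.
  have [A bA hA] := complete_boundary_arc hT co (lexx _) h1 h2 tch.
  by exists A => //; rewrite -qp; apply: hA; lra.
have [l0 l0G l0p] := left_guard_of_closure clp em'.
have [r0 r0G [r0p _]] := hr.
have [|lo [hi [q [l [r [co hphi qp [t ht tch]]]]]]] := complete_through hT pG em'.
  by exists l0, r0.
have /andP[h1 h2] := ht.
have h0 : lo <= phi' by lra.
have [A bA hA] := complete_boundary_arc hT co h0 h1 h2 tch.
by exists A => //; rewrite -qp; apply: hA; lra.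
Qed.

End Frontier.

(** * Uniqueness of the motion *)

Section Uniqueness.
Context {R : realType}.
Variables (G : {fset R * R}) (Theta : R).
Hypothesis hT : 0 < Theta < pi.
Implicit Types (p l r g u v : R * R) (q : R -> R * R) (a b x y s t c k : R).

Let sT : 0 < sin Theta. Proof. exact: sin_gt0_pi. Qed.
Let sTx x : sin (x + Theta - x) = sin Theta. Proof. by congr sin; ring. Qed.
Let sDT x y : sin (x + Theta - (y + Theta)) = sin (x - y).
Proof. by congr sin; ring. Qed.

(** What a tunnel provides by definition. The monotonicity in [motion] is known only for constructed
    motions and cannot be assumed for the arcs that are counted. *)
Record sweeping a b q : Prop := Sweeping {
  sw_lt : a < b;
  sw_cont : {within `[a, b], continuous q};
  sw_empty : forall x, a <= x <= b -> empty_cone G Theta (q x) x;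
  sw_touch : forall x, a <= x <= b -> exists l r, touch G Theta (q x) x l r;
  sw_free : forall x, a < x < b -> q x \notin G;
  sw_ends : q a \in G /\ q b \in G }.

(** If [r] were the apex [p], then [l] would lie ahead of [r] along the left ray at [x], and at the
    later moment [y] the point [r] could not be strictly ahead of the apex. *)
Lemma right_pivot_neq p (q : R * R) x y l r : touch G Theta p x l r ->
  touch G Theta q y l r -> q \notin G -> 0 < sin (y - x) -> r <> p.
Proof.
move=> [_ _ [c c0 lE] _] ty qG sxy rp.
have [s' [s [s'0 s0 lE' rE']]] := touch_placed ty qG.
have e : l - r = c *: dir (x + Theta) by rewrite {1}lE rp addrC addKr.
have : cross (l - r) (dir (y + Theta)) = c * sin (y - x).
  by rewrite e crossZl cross_dir sDT.
have -> : l - r = s' *: dir (y + Theta) - s *: dir y.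
  by rewrite lE' rE' opprD addrACA subrr add0r.
rewrite crossDl crossNl !crossZl !cross_dir subrr sin0 sTx mulr0 add0r.
have := mulr_gt0 s0 sT; have := mulr_ge0 c0 (ltW sxy); lra.
Qed.

Lemma touch_right_limit a b q x : sweeping a b q -> a <= x < b ->
  \forall y \near x^'+, forall l r, touch G Theta (q y) y l r -> touch G Theta (q x) x l r.
Proof.
move=> sw hx.
have : \forall y \near x^'+, forall l, l \in G -> forall r, r \in G ->
    touch G Theta (q y) y l r -> touch G Theta (q x) x l r.
  apply: filter_fset => l lG; apply: filter_fset => r rG.
  have [h|h] := pselect (touch G Theta (q x) x l r).
    by near=> y.
  have [|e e0 he] := touch_away (sw_cont sw) _ h; first by lra.
  apply/at_rightP; exists (Num.min e (b - x)); first by rewrite lt_min e0 /=; lra.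
  move=> y; have h1 : Num.min e (b - x) <= e by rewrite ge_min lexx.
  have h2 : Num.min e (b - x) <= b - x by rewrite ge_min lexx orbT.
  move=> hy ty; exfalso; apply: (he y) ty; first by lra.
  by rewrite gtr0_norm; lra.
by apply: filterS => y h l r ty; have [lG rG _ _] := ty; apply: h.
Unshelve. all: by end_near.
Qed.

Lemma touch_left_limit a b q x : sweeping a b q -> a < x <= b ->
  \forall y \near x^'-, forall l r, touch G Theta (q y) y l r -> touch G Theta (q x) x l r.
Proof.
move=> sw hx.
have : \forall y \near x^'-, forall l, l \in G -> forall r, r \in G ->
    touch G Theta (q y) y l r -> touch G Theta (q x) x l r.
  apply: filter_fset => l lG; apply: filter_fset => r rG.
  have [h|h] := pselect (touch G Theta (q x) x l r).
    by near=> y.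
  have [|e e0 he] := touch_away (sw_cont sw) _ h; first by lra.
  apply/at_leftP; exists (Num.min e (x - a)); first by rewrite lt_min e0 /=; lra.
  move=> y; have h1 : Num.min e (x - a) <= e by rewrite ge_min lexx.
  have h2 : Num.min e (x - a) <= x - a by rewrite ge_min lexx orbT.
  move=> hy ty; exfalso; apply: (he y) ty; first by lra.
  by rewrite ltr0_norm; lra.
by apply: filterS => y h l r ty; have [lG rG _ _] := ty; apply: h.
Unshelve. all: by end_near.
Qed.

Lemma right_margin a b q x : sweeping a b q -> a <= x < b ->
  \forall y \near x^'+, forall r, r \in G -> right_ray (q x) x r -> r <> q x ->
    0 < cross (r - q y) (dir (y + Theta)).
Proof.
move=> sw hx; apply: filter_fset => r rG.
have [[[k k0 rE] rq]|h] := pselect (right_ray (q x) x r /\ r <> q x); last first.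
  by near=> y => h1 h2; case: h.
have kp : 0 < k.
  rewrite lt_def k0 andbT; apply/eqP => kz; apply: rq.
  by rewrite rE kz scale0r addr0.
have [cc _] := within_cross_dir Theta r (sw_cont sw).
have [||e e0 he] := @within_near_pos _ a b _ x (@within_opp _ _ _ _ cc).
- by lra.
- have -> : r - q x = k *: dir x by rewrite rE addrC addKr.
  rewrite crossZr cross_dir -mulrN -sinN opprB sTx.
  exact: mulr_gt0.
apply/at_rightP; exists (Num.min e (b - x)); first by rewrite lt_min e0 /=; lra.
move=> y; have h1 : Num.min e (b - x) <= e by rewrite ge_min lexx.
have h2 : Num.min e (b - x) <= b - x by rewrite ge_min lexx orbT.
move=> hy _ _; rewrite crossC; apply: he; first by lra.
by rewrite gtr0_norm; lra.
Unshelve. all: by end_near.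
Qed.

Lemma empty_right p x g : empty_cone G Theta p x -> g \in G ->
  0 < cross (g - p) (dir (x + Theta)) -> cross (dir x) (g - p) <= 0.
Proof.
move=> /(empty_coneP _ hT) em gG h; rewrite leNgt; apply/negP => k.
exact: (em g gG).
Qed.

Lemma empty_left p x g : empty_cone G Theta p x -> g \in G ->
  0 < cross (dir x) (g - p) -> cross (g - p) (dir (x + Theta)) <= 0.
Proof.
move=> /(empty_coneP _ hT) em gG h; rewrite leNgt; apply/negP => k.
exact: (em g gG).
Qed.

(** If [p1] were ahead of [p2] on their common right line, the left guard touched from [p1] would be
    inside the empty cone at [p2]. *)
Lemma same_right_line p1 p2 x l1 r1 s1' s1 : empty_cone G Theta p2 x ->
  l1 \in G -> placed Theta p1 x l1 r1 s1' s1 ->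
  cross (dir x) (p1 - p2) = 0 -> cross (p1 - p2) (dir (x + Theta)) <= 0.
Proof.
move=> em l1G [s1'0 _ lE _] h0.
have lp : l1 - p2 = (p1 - p2) + s1' *: dir (x + Theta) by rewrite lE addrAC.
have := empty_left em l1G; rewrite lp crossDr crossDl crossZr crossZl !cross_dir.
by rewrite h0 add0r subrr sin0 mulr0 addr0 sTx; apply; exact: mulr_gt0.
Qed.

(** Shortly after [x], the right guard of either sweep was already on the common right ray at [x],
    so it is still on the inner side of the left line of the other sweep. Emptiness then forbids it
    to be inside the other right line. Applied both ways, this identifies the right lines, and
    [same_right_line], again both ways, the apices. *)
Lemma sweeping_local a1 b1 a2 b2 q1 q2 x :
  sweeping a1 b1 q1 -> sweeping a2 b2 q2 -> a1 <= x < b1 -> a2 <= x < b2 ->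
  q1 x = q2 x -> \forall y \near x^'+, q1 y = q2 y.
Proof.
move=> w1 w2 h1 h2 e.
have l1 := touch_right_limit w1 h1; have l2 := touch_right_limit w2 h2.
have m1 := right_margin w1 h1; have m2 := right_margin w2 h2.
have sx := sin_near_right x.
have n1 : \forall y \near x^'+, x < y < b1.
  by apply/at_rightP; exists (b1 - x) => [|y]; lra.
have n2 : \forall y \near x^'+, x < y < b2.
  by apply/at_rightP; exists (b2 - x) => [|y]; lra.
near=> y.
have sy : 0 < sin (y - x) by near: y.
have y1 : x < y < b1 by near: y.
have y2 : x < y < b2 by near: y.
have f1 : q1 y \notin G by apply: (sw_free w1); lra.
have f2 : q2 y \notin G by apply: (sw_free w2); lra.
have em1 := sw_empty w1 (ltac:(lra) : a1 <= y <= b1).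
have em2 := sw_empty w2 (ltac:(lra) : a2 <= y <= b2).
have [la [ra ta]] := sw_touch w1 (ltac:(lra) : a1 <= y <= b1).
have [lb [rb tb]] := sw_touch w2 (ltac:(lra) : a2 <= y <= b2).
have ta0 : touch G Theta (q1 x) x la ra by move: la ra ta; near: y.
have tb0 : touch G Theta (q2 x) x lb rb by move: lb rb tb; near: y.
have ran := right_pivot_neq ta0 ta f1 sy.
have rbn := right_pivot_neq tb0 tb f2 sy.
have [laG raG _ rax] := ta0; have [lbG rbG _ rbx] := tb0.
have ma : 0 < cross (ra - q2 y) (dir (y + Theta)).
  rewrite e in rax ran; move: ra raG rax ran {ta ta0}; near: y; exact: m2.
have mb : 0 < cross (rb - q1 y) (dir (y + Theta)).
  rewrite -e in rbx rbn; move: rb rbG rbx rbn {tb tb0}; near: y; exact: m1.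
have [sa' [sa pa]] := touch_placed ta f1.
have [sb' [sb pb]] := touch_placed tb f2.
have ca := empty_right em2 raG ma; have cb := empty_right em1 rbG mb.
have c0 : cross (dir y) (q1 y - q2 y) = 0.
  move: ca cb; rewrite (pl_r pa) (pl_r pb) ![_ + _ *: _ - _]addrAC !crossDr.
  by rewrite !crossZr cross_dirxx !mulr0 !addr0 !crossNr; lra.
have c0' : cross (dir y) (q2 y - q1 y) = 0 by rewrite -opprB crossNr c0 oppr0.
have d1 := same_right_line em2 laG pa c0.
have d2 := same_right_line em1 lbG pb c0'.
apply: (point_eq hT c0); apply: le_anti; rewrite d1 /=.
by rewrite -opprB crossNl oppr_ge0.
Unshelve. all: by end_near.
Qed.

Lemma within_sqdist a b q1 q2 : {within `[a, b], continuous q1} ->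
  {within `[a, b], continuous q2} ->
  {within `[a, b], continuous (fun x => sqdist (q1 x) (q2 x))}.
Proof.
move=> /within_fst_snd[c1 c2] /within_fst_snd[d1 d2].
move/subspace_continuousP : c1 => c1; move/subspace_continuousP : c2 => c2.
move/subspace_continuousP : d1 => d1; move/subspace_continuousP : d2 => d2.
have e1 x (hx : `[a, b]%classic x) := @cvgB _ _ _ _ _ _ _ _ _ (c1 x hx) (d1 x hx).
have e2 x (hx : `[a, b]%classic x) := @cvgB _ _ _ _ _ _ _ _ _ (c2 x hx) (d2 x hx).
apply/subspace_continuousP => x hx; rewrite /sqdist.
by apply: cvgD; apply: cvgM; [exact: e1|exact: e1|exact: e2|exact: e2].
Qed.

(** At the infimum of the moments of disagreement the sweeps agree by continuity, and then shortly
    afterwards too. The final moments are equal because each sweep ends at the first guard reached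
    by its apex after [s]. *)
Lemma sweeping_unique a1 b1 a2 b2 q1 q2 s :
  sweeping a1 b1 q1 -> sweeping a2 b2 q2 -> a1 <= s < b1 -> a2 <= s < b2 ->
  q1 s = q2 s -> b1 = b2 /\ forall x, s <= x <= b1 -> q1 x = q2 x.
Proof.
move=> w1 w2 h1 h2 e.
have agree x : s <= x -> x <= b1 -> x <= b2 -> q1 x = q2 x.
  move=> sx xb1 xb2; apply: contrapT => ne.
  pose Bad := [set x | [/\ s <= x, x <= b1, x <= b2 & q1 x <> q2 x]].
  have hB : has_inf Bad by split; [exists x; split|exists s => y []].
  pose t := inf Bad.
  have tB y : Bad y -> t <= y by move=> By; apply: ge_inf => //; exact: hB.2.
  have tx : t <= x by apply: tB; split.
  have st : s <= t by apply: lb_le_inf; [exact: hB.1|move=> y []].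
  have before y : s <= y < t -> q1 y = q2 y.
    move=> hy; apply: contrapT => ney.
    have : t <= y by apply: tB; split=> //; lra.
    by lra.
  have at_t : q1 t = q2 t.
    have [->//|tn] := eqVneq t s.
    apply: contrapT => net; have st' : s < t by rewrite lt_neqAle eq_sym tn.
    have c1 : {within `[s, t], continuous q1}.
      apply: continuous_subspaceW (sw_cont w1) => y /=; rewrite !in_itv /=; lra.
    have c2 : {within `[s, t], continuous q2}.
      apply: continuous_subspaceW (sw_cont w2) => y /=; rewrite !in_itv /=; lra.
    have [||d d0 hd] := @within_near_pos _ s t _ t (within_sqdist c1 c2).
    - by rewrite st lexx.
    - exact: sqdist_gt0.
    pose y := Num.max s (t - d / 2).
    have y1 : s <= y < t by rewrite le_max lexx /= gt_max; lra.
    have y2 : t - d / 2 <= y by rewrite le_max lexx orbT.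
    have := hd y (ltac:(lra)) (ltac:(rewrite ltr0_norm; lra)).
    by rewrite before// /sqdist !subrr expr0n /= addr0 ltxx.
  have tx' : t < x.
    rewrite lt_neqAle tx andbT; apply/eqP => tE; apply: ne; by rewrite -tE.
  have /at_rightP[d d0 hd] := sweeping_local w1 w2 (ltac:(lra) : a1 <= t < b1)
    (ltac:(lra) : a2 <= t < b2) at_t.
  have [y By yd] := inf_adherent d0 hB.
  have ty := tB y By; case: By => _ _ _; apply.
  have [->//|yt] := eqVneq y t; apply: hd.
  by rewrite lt_neqAle eq_sym yt ty.
have bb : b1 = b2.
  have [e1 e2] : q1 b1 \in G /\ q2 b2 \in G by split; [case: (sw_ends w1)|case: (sw_ends w2)].
  have [b12|b21|//] := ltgtP b1 b2.
  - have ee := agree b1 (ltac:(lra)) (lexx _) (ltW b12).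
    by have := sw_free w2 (ltac:(lra) : a2 < b1 < b2); rewrite -ee e1.
  - have ee := agree b2 (ltac:(lra)) (ltW b21) (lexx _).
    by have := sw_free w1 (ltac:(lra) : a1 < b2 < b1); rewrite ee e2.
split=> // x hx; apply: agree; lra.
Qed.

End Uniqueness.

(** * Counting arcs *)

Section Counting.
Context {R : realType}.
Variables (G : {fset R * R}) (Theta : R).
Hypothesis hT : 0 < Theta < pi.
Implicit Types (p l r g h u v : R * R) (q : R -> R * R) (a b x y s t c k : R).
Implicit Types (A : set (R * R)).

Let sT : 0 < sin Theta. Proof. exact: sin_gt0_pi. Qed.
Let sTx x : sin (x + Theta - x) = sin Theta. Proof. by congr sin; ring. Qed.

Record arc_data A q a b s t l r : Prop := ArcData {
  ad_sweeping : sweeping G Theta a b q;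
  ad_range : [/\ a <= s, s < t & t <= b];
  ad_touch : bounded_touch G Theta s t q l r;
  ad_max : forall s' t', a <= s' <= s -> t <= t' <= b ->
    bounded_touch G Theta s' t' q l r -> s' = s /\ t' = t;
  ad_image : A = q @` [set x | s <= x <= t];
  ad_normal : 0 <= s < 2 * pi }.

Lemma ray_dir p phi psi g : dir phi = dir psi :> R * R -> ray p phi g -> ray p psi g.
Proof. by move=> e [t t0 ->]; exists t; rewrite // e. Qed.

Lemma touch_dir p x y l r : dir x = dir y :> R * R ->
  dir (x + Theta) = dir (y + Theta) :> R * R ->
  touch G Theta p x l r -> touch G Theta p y l r.
Proof.
by move=> e e' [? ? lx rx]; split => //; [exact: ray_dir e' lx|exact: ray_dir e rx].
Qed.

Lemma empty_dir p x y : dir x = dir y :> R * R ->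
  dir (x + Theta) = dir (y + Theta) :> R * R ->
  empty_cone G Theta p x -> empty_cone G Theta p y.
Proof.
move=> e e' /(empty_coneP _ hT) em; apply/(empty_coneP _ hT) => g gG.
by rewrite -e -e'; exact: em.
Qed.

(** A shift of the time by a period of [dir] leaves the arc unchanged as a point set and brings its
    start into [[0, 2 * pi)]. *)
Lemma boundary_arc_data A : boundary_arcs G Theta A ->
  exists q a b s t l r, arc_data A q a b s t l r.
Proof.
move=> [[a b q] [h [[/= ab cq etq fq [qa qb _]] _ [l [r [s [t dr]]]] _]]].
move: dr => [/= as_ st tb tch [mx AE _]]; have [psi [hpsi e]] := dir_mod s.
pose c := psi - s.
have d1 x : dir (x - c) = dir x :> R * R by rewrite -[LHS]e -/c subrK.
have d2 x : dir (x - c + Theta) = dir (x + Theta) :> R * R.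
  by rewrite -[LHS]e -/c; congr dir; ring.
have bt s' t' : bounded_touch G Theta (s' + c) (t' + c) (fun x => q (x - c)) l r ->
    forall x, s' <= x <= t' -> touch G Theta (q x) x l r.
  move=> hb x hx; have := hb (x + c) (ltac:(lra)); rewrite addrK.
  apply: touch_dir; [by rewrite -(d1 (x + c)) addrK|by rewrite -(d2 (x + c)) addrK].
exists (fun x => q (x - c)), (a + c), (b + c), (s + c), (t + c), l, r; split.
- split.
  + by rewrite ltrD2r.
  + move/subspace_continuousP : cq => cq.
    apply/subspace_continuousP => x; rewrite /= in_itv /= => hx.
    have qx : q y @[y --> within `[a, b] (nbhs (x - c))] --> q (x - c).
      by apply: cq; rewrite /= in_itv /=; lra.
    have nx : (y - c) @[y --> within `[(a + c), (b + c)] (nbhs x)]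
        --> within `[a, b] (nbhs (x - c)).
      move=> W hW.
      have cn : (y - c) @[y --> x] --> x - c.
        exact: (@cvgB _ _ _ _ _ _ _ _ _ (@cvg_id _ (nbhs x)) (cvg_cst c)).
      have h1 : \forall y \near x, `[a, b]%classic (y - c) -> W (y - c).
        exact: (cn _ hW).
      have h2 : \forall y \near x, `[(a + c), (b + c)]%classic y -> W (y - c).
        apply: filterS h1 => y hy ay; apply: hy; move: ay; rewrite /= !in_itv /=; lra.
      exact: h2.
    exact: (cvg_comp _ _ nx qx).
  + move=> x hx; have [em _] := etq (x - c) (ltac:(lra)).
    by apply: empty_dir em.
  + move=> x hx; have [_ [l' [r' tx]]] := etq (x - c) (ltac:(lra)).
    by exists l', r'; apply: touch_dir tx.
  + by move=> x hx; apply: fq; lra.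
  + by rewrite !addrK.
- by split; lra.
- move=> x hx; have := tch (x - c) (ltac:(lra)).
  exact: touch_dir.
- move=> s' t' hs' ht' hb.
  have [|||e1 e2] := mx (s' - c) (t' - c); [lra|lra| |by split; lra].
  by apply: bt; rewrite !subrK.
- rewrite AE; apply/seteqP; split => p [x /= hx <-].
    by exists (x + c); rewrite /= ?addrK//; lra.
  by exists (x - c) => //=; lra.
- by rewrite /c addrC subrK.
Qed.

Lemma two_on_ray p phi g1 g2 : p \notin G -> g1 \in G -> g2 \in G ->
  ray p phi g1 -> ray p phi g2 -> g1 <> g2 ->
  exists g k, [/\ g \in G, 0 < k, g = p + k *: dir phi
    & exists2 g', g' \in G & ray g phi g' /\ g' <> g].
Proof.
move=> pG; wlog: g1 g2 / exists k1 k2, [/\ 0 <= k1, k1 <= k2,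
    g1 = p + k1 *: dir phi & g2 = p + k2 *: dir phi].
  move=> H G1 G2 r1 r2 ne; have [k1 k10 e1] := r1; have [k2 k20 e2] := r2.
  have [k12|k21] := lerP k1 k2.
    by apply: (H g1 g2) => //; exists k1, k2.
  apply: (H g2 g1) => //; last by move=> e; apply: ne.
  by exists k2, k1; rewrite k20 (ltW k21).
move=> [k1 [k2 [k10 k12 e1 e2]]] G1 G2 _ _ ne.
exists g1, k1; split => //.
  rewrite lt_def k10 andbT; apply/eqP => z.
  by move: pG; rewrite -(addr0 p) -(scale0r (dir phi)) -z -e1 G1.
exists g2 => //; split; last by move=> e; apply: ne.
by exists (k2 - k1); [rewrite subr_ge0|rewrite (sub_ray p) -e1 -e2 addrC subrK].
Qed.

(** Pushed forward along one of its rays, a cone stays inside itself. *)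
Lemma empty_forward p x k : 0 <= k -> empty_cone G Theta p x ->
  empty_cone G Theta (p + k *: dir x) x.
Proof.
move=> k0 /(empty_coneP _ hT) em; apply/(empty_coneP _ hT) => h hG.
rewrite opprD addrA [cross (dir x) _]crossDr [cross _ (dir (x + Theta))]crossDl.
rewrite crossNr crossNl crossZr crossZl !cross_dir subrr sin0 sTx => -[h1 h2].
have := mulr_ge0 k0 (ltW sT) => ks.
by apply: (em h hG); split; lra.
Qed.

Lemma empty_left_forward p x k : 0 <= k -> empty_cone G Theta p x ->
  empty_cone G Theta (p + k *: dir (x + Theta)) x.
Proof.
move=> k0 /(empty_coneP _ hT) em; apply/(empty_coneP _ hT) => h hG.
rewrite opprD addrA [cross (dir x) _]crossDr [cross _ (dir (x + Theta))]crossDl.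
rewrite crossNr crossNl crossZr crossZl !cross_dir subrr sin0 sTx => -[h1 h2].
have := mulr_ge0 k0 (ltW sT) => ks.
by apply: (em h hG); split; lra.
Qed.

(* The guard to which an arc is charged sees an empty cone at the moment when the
   arc starts: it is the apex itself (0), or the nearer of two guards on the right
   ray (1) or on the left ray (2). *)
Definition charge (c : nat) g s q a : Prop :=
  match c with
  | 0%N => [/\ s = a, q s = g & exists2 h, h \in G & right_ray g s h /\ h <> g]
  | 1%N => [/\ a < s, exists2 k, 0 < k & g = q s + k *: dir s
            & exists2 h, h \in G & right_ray g s h /\ h <> g]
  | _ => [/\ a < s, exists2 k, 0 < k & g = q s + k *: dir (s + Theta)
          & exists2 h, h \in G & left_ray Theta g s h /\ h <> g]
  end.

Lemma charge_exists A q a b s t l r : arc_data A q a b s t l r ->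
  exists (c : 'I_3) g, [/\ g \in G, empty_cone G Theta g s & charge c g s q a].
Proof.
move=> [sw [as_ st tb] tch mx _ _].
have [qaG _] := sw_ends sw.
have em : empty_cone G Theta (q s) s by apply: (sw_empty sw); lra.
have ts := tch s (ltac:(lra)).
have [sa|sna] := eqVneq s a.
  exists (@Ordinal 3 0 isT), (q s); split => //; first by rewrite sa.
  split => //; exists r; first by case: ts.
  split; first by case: ts.
  have [y hy [sy fy]] : exists2 y, s < y < t & 0 < sin (y - s) /\ q y \notin G.
    apply: (near_right_witness st); apply: filterI; first exact: sin_near_right.
    by apply/at_rightP; exists (t - s) => [|y hy]; [lra|apply: (sw_free sw); lra].
  exact: (right_pivot_neq hT ts (tch y (ltac:(lra))) fy sy).
have as' : a < s by rewrite lt_neqAle eq_sym sna.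
have fs : q s \notin G by apply: (sw_free sw); lra.
(* Pairs touched shortly before [s] are touched at [s] too. If all of them were [(l, r)], the
   interval could be prolonged to the left; so a second pair is touched at [s], and one ray carries
   two guards. *)
have [l1 [r1 [t1 ne]]] : exists l1 r1, touch G Theta (q s) s l1 r1 /\ (l1, r1) <> (l, r).
  have /at_leftP[e e0 he] := touch_left_limit sw (ltac:(lra) : a < s <= b).
  pose s' := Num.max a (s - e / 2).
  have h1 : a <= s' by rewrite le_max lexx.
  have h2 : s - e / 2 <= s' by rewrite le_max lexx orbT.
  have h3 : s' < s by rewrite gt_max; lra.
  apply: contrapT => none.
  have [|||ss _] := mx s' t; [lra|lra| |lra].
  move=> x hx; have [xs|xs] := lerP s x; first by apply: tch; lra.
  have [l1 [r1 tx]] := sw_touch sw (ltac:(lra) : a <= x <= b).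
  have tx' := he x (ltac:(lra)) _ _ tx.
  have : (l1, r1) = (l, r) by apply: contrapT => ne; apply: none; exists l1, r1.
  by case=> <- <-.
have [lG rG ls rs] := ts; have [l1G r1G l1s r1s] := t1.
have [re|rn] := eqVneq r1 r; last first.
  have [g [k [gG k0 gE hg]]] := two_on_ray fs r1G rG r1s rs (elimN eqP rn).
  exists (@Ordinal 3 1 isT), g; split => //; last by split=> //; exists k.
  by rewrite gE; apply: empty_forward => //; exact: ltW.
have ln : l1 <> l by move=> e; apply: ne; rewrite e re.
have [g [k [gG k0 gE hg]]] := two_on_ray fs l1G lG l1s ls ln.
exists (@Ordinal 3 2 isT), g; split => //; last by split=> //; exists k.
by rewrite gE; apply: empty_left_forward => //; exact: ltW.
Qed.

Lemma ray_proper p phi g : ray p phi g -> g <> p -> exists2 k, 0 < k & g = p + k *: dir phi.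
Proof.
move=> [k k0 gE] gp; exists k => //; rewrite lt_def k0 andbT; apply/eqP => kz.
by apply: gp; rewrite gE kz scale0r addr0.
Qed.

(** For [s1 < s2 < s1 + Theta] the right ray at [s2] runs inside the cone at [s1], and the left ray
    at [s1] inside the cone at [s2]. The guard seen on such a ray contradicts emptiness. *)
Lemma charge_angle (c : 'I_3) g s1 s2 q1 q2 a1 a2 : `|s1 - s2| < Theta ->
  empty_cone G Theta g s1 -> empty_cone G Theta g s2 ->
  charge c g s1 q1 a1 -> charge c g s2 q2 a2 -> s1 = s2.
Proof.
wlog s12 : s1 s2 q1 q2 a1 a2 / s1 <= s2.
  move=> H hs e1 e2 c1 c2; have [le|lt] := lerP s1 s2.
    exact: (H _ _ _ _ _ _ le hs e1 e2 c1 c2).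
  by rewrite distrC in hs; symmetry; apply: (H _ _ _ _ _ _ (ltW lt) hs e2 e1 c2 c1).
move=> hs e1 e2 c1 c2; apply/eqP; rewrite eq_le s12 /= leNgt; apply/negP => lt.
have lt' : s2 < s1 + Theta by move: hs; rewrite ltr0_norm; lra.
have right_case h : h \in G -> right_ray g s2 h -> h <> g -> False.
  move=> hG /ray_proper hr /hr[k k0 hE]; apply: (e1 h hG).
  by exists k, s2; rewrite lt lt'.
have left_case h : h \in G -> left_ray Theta g s1 h -> h <> g -> False.
  move=> hG /ray_proper hr /hr[k k0 hE]; apply: (e2 h hG).
  by exists k, (s1 + Theta); rewrite lt' ltrD2r lt.
case: c c1 c2 => -[|[|[|//]]] _ /=.
- by move=> _ [_ _ [h hG [hr hn]]]; exact: (right_case h).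
- by move=> _ [_ _ [h hG [hr hn]]]; exact: (right_case h).
- by move=> [_ _ [h hG [hr hn]]] _; exact: (left_case h).
Qed.

Lemma charge_apex (c : 'I_3) g s q1 q2 a1 a2 b1 b2 :
  sweeping G Theta a1 b1 q1 -> sweeping G Theta a2 b2 q2 ->
  a1 <= s < b1 -> a2 <= s < b2 ->
  charge c g s q1 a1 -> charge c g s q2 a2 -> q1 s = q2 s.
Proof.
(* On the line through [g], the apex farther back would have a guard touched by the other cone
   strictly inside its own cone. *)
have main q q' a b a' b' k k' : sweeping G Theta a b q -> sweeping G Theta a' b' q' ->
    a < s < b -> a' <= s <= b' ->
    (q s + k *: dir s = q' s + k' *: dir s \/
     q s + k *: dir (s + Theta) = q' s + k' *: dir (s + Theta)) -> k < k' -> False.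
  move=> w w' hs hs' e kk'.
  have em := sw_empty w' hs'.
  have [l [r ts]] := sw_touch w (ltac:(lra) : a <= s <= b).
  have [lG rG _ _] := ts.
  have [s1' [s1 p1]] := touch_placed ts (sw_free w hs).
  move/(empty_coneP _ hT) : em => em.
  have d0 : 0 < k' - k by lra.
  case: e => e.
    apply: (em l lG).
    have -> : l - q' s = s1' *: dir (s + Theta) + (k' - k) *: dir s.
      rewrite (pl_l p1).
      have -> : q s = q' s + k' *: dir s - k *: dir s by rewrite -e addrK.
      by rewrite scalerBl; apply: pairE => /=; ring.
    rewrite crossDr crossDl !crossZr !crossZl !cross_dir !subrr sin0 !mulr0 sTx.
    by rewrite addr0 add0r !mulr_gt0// (pl_s' p1).
  apply: (em r rG).
  have -> : r - q' s = s1 *: dir s + (k' - k) *: dir (s + Theta).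
    rewrite (pl_r p1).
    have -> : q s = q' s + k' *: dir (s + Theta) - k *: dir (s + Theta) by rewrite -e addrK.
    by rewrite scalerBl; apply: pairE => /=; ring.
  rewrite crossDr crossDl !crossZr !crossZl !cross_dir !subrr sin0 !mulr0 sTx.
  by rewrite addr0 add0r !mulr_gt0// (pl_s p1).
move=> w1 w2 h1 h2.
case: c => -[|[|[|//]]] _ /=.
- by move=> [_ -> _] [_ -> _].
- move=> [as1 [k1 k10 e1] _] [as2 [k2 k20 e2] _].
  have [k12|k12|k12] := ltgtP k1 k2.
  + by case: (main q1 q2 a1 b1 a2 b2 k1 k2) => //; [lra|lra|left; rewrite -e1].
  + by case: (main q2 q1 a2 b2 a1 b1 k2 k1) => //; [lra|lra|left; rewrite -e1].
  + by apply: (addIr (k1 *: dir s)); rewrite -e1 e2 k12.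
- move=> [as1 [k1 k10 e1] _] [as2 [k2 k20 e2] _].
  have [k12|k12|k12] := ltgtP k1 k2.
  + by case: (main q1 q2 a1 b1 a2 b2 k1 k2) => //; [lra|lra|right; rewrite -e1].
  + by case: (main q2 q1 a2 b2 a1 b1 k2 k1) => //; [lra|lra|right; rewrite -e1].
  + by apply: (addIr (k1 *: dir (s + Theta))); rewrite -e1 e2 k12.
Qed.

Lemma same_start A1 A2 q1 q2 a1 a2 b1 b2 s t1 t2 l1 l2 r1 r2 :
  arc_data A1 q1 a1 b1 s t1 l1 r1 -> arc_data A2 q2 a2 b2 s t2 l2 r2 ->
  q1 s = q2 s -> A1 = A2.
Proof.
wlog t12 : A1 A2 q1 q2 a1 a2 b1 b2 t1 t2 l1 l2 r1 r2 / t1 <= t2.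
  move=> H d1 d2 e; have [le|lt] := lerP t1 t2.
    exact: (H _ _ _ _ _ _ _ _ _ _ _ _ _ _ le d1 d2 e).
  by symmetry; apply: (H _ _ _ _ _ _ _ _ _ _ _ _ _ _ (ltW lt) d2 d1).
move=> [w1 [as1 st1 tb1] c1 m1 i1 _] [w2 [as2 st2 tb2] c2 m2 i2 _] e.
have [bb agree] := sweeping_unique hT w1 w2 (ltac:(lra) : a1 <= s < b1)
  (ltac:(lra) : a2 <= s < b2) e.
have [y hy sy] := near_right_witness st1 (sin_near_right s).
(* A touched guard lies on the rays of two moments, [s] and [y], whose lines are not parallel; so
   the common path determines the pair. *)
have eqv u v (phi psi : R) p p' : sin (psi - phi) != 0 -> ray p phi u -> ray p phi v ->
    ray p' psi u -> ray p' psi v -> u = v.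
  move=> sn [k1 _ u1] [k2 _ v1] [k3 _ u2] [k4 _ v2]; apply/eqP; rewrite -subr_eq0.
  apply/eqP/(@frame_eq0 _ _ phi psi) => //.
    by rewrite u1 v1 -sub_ray crossZl cross_dirxx mulr0.
  by rewrite u2 v2 -sub_ray crossZl cross_dirxx mulr0.
have [_ _ la ra] := c1 s (ltac:(lra)); have [_ _ lb rb] := c1 y (ltac:(lra)).
have [_ _ lc rc] := c2 s (ltac:(lra)); have [_ _ ld rd] := c2 y (ltac:(lra)).
rewrite -e in lc rc; rewrite -agree in ld rd; last by lra.
have le : l1 = l2.
  apply: (eqv _ _ (s + Theta) (y + Theta) _ _ _ la lc lb ld).
  have -> : y + Theta - (s + Theta) = y - s by ring.
  by rewrite gt_eqF.
have re : r1 = r2 by apply: (eqv _ _ s y _ _ _ ra rc rb rd); rewrite gt_eqF.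
have [|||_ tt] := m1 s t2; [lra|lra| |].
  by move=> x hx; rewrite agree; [rewrite le re; apply: c2|lra].
rewrite i1 i2 -tt; apply/seteqP; split => p [x /= hx <-]; exists x => //.
  by rewrite agree//; lra.
by rewrite agree//; lra.
Qed.

(** The number [j] is the window of length [Theta] in which the arc starts; within one window, kind
    and guard determine the start by [charge_angle]. *)
Definition code (A : set (R * R)) (c : 'I_3) g (j : nat) : Prop :=
  exists q a b s t l r, [/\ arc_data A q a b s t l r, empty_cone G Theta g s,
    charge c g s q a & Num.truncn (s / Theta) = j].

Lemma code_exists A : boundary_arcs G Theta A ->
  exists (c : 'I_3) g j, [/\ g \in G, (j <= Num.truncn (2 * pi / Theta))%N & code A c g j].
Proof.
move=> /boundary_arc_data[q [a [b [s [t [l [r d]]]]]]].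
have [c [g [gG em ch]]] := charge_exists d.
exists c, g, (Num.truncn (s / Theta)); split => //.
  have [s0 s2] := andP (ad_normal d).
  apply: Num.Theory.le_truncn; rewrite ler_pM2r ?ltW//.
  by rewrite invr_gt0; case/andP: hT.
by exists q, a, b, s, t, l, r.
Qed.

Lemma code_inj A1 A2 (c : 'I_3) g j : code A1 c g j -> code A2 c g j -> A1 = A2.
Proof.
move=> [q1 [a1 [b1 [s1 [t1 [l1 [r1 [d1 e1 c1 j1]]]]]]]].
move=> [q2 [a2 [b2 [s2 [t2 [l2 [r2 [d2 e2 c2 j2]]]]]]]].
have T0 : 0 < Theta by case/andP: hT.
have s12 : s1 = s2.
  apply: (charge_angle _ e1 e2 c1 c2).
  have [s10 _] := andP (ad_normal d1); have [s20 _] := andP (ad_normal d2).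
  have := Num.Theory.truncn_itv (divr_ge0 s10 (ltW T0)).
  have := Num.Theory.truncn_itv (divr_ge0 s20 (ltW T0)).
  rewrite j1 j2 -natr1 !ler_pdivlMr// !ltr_pdivrMr// ltr_norml.
  by move=> /andP[? ?] /andP[? ?]; apply/andP; split; lra.
rewrite -s12 in d2 c2.
have [as1 st1 tb1] := ad_range d1; have [as2 st2 tb2] := ad_range d2.
apply: (same_start d1 d2); apply: (charge_apex (ad_sweeping d1) (ad_sweeping d2) _ _ c1 c2).
  by lra.
by lra.
Qed.

Lemma boundary_arcs_card :
  finite_set (boundary_arcs G Theta) /\
  (#|` fset_set (boundary_arcs G Theta)| <=
     3 * #|` G| * (Num.truncn (2 * pi / Theta)).+1)%fset%N.
Proof.
pose N := Num.truncn (2 * pi / Theta).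
pose C := ('I_3 * G * 'I_N.+1)%type.
(* By [code_inj] a code belongs to at most one arc, so the chosen set is that arc; codes of no arc
   are sent to the default [set0]. *)
pose decode (x : C) : set (R * R) :=
  xget set0 [set A | code A x.1.1 (val x.1.2) (val x.2)].
pose F := seq_fset tt (map decode (enum {: 'I_3 * G * 'I_N.+1})).
have sub : boundary_arcs G Theta `<=` [set` F].
  move=> A /code_exists[c [g [j [gG jN cA]]]] /=.
  rewrite seq_fsetE; apply/mapP.
  exists (c, [` gG]%fset, Ordinal (jN : (j < N.+1)%N)); first by rewrite mem_enum.
  by rewrite /decode; case: xgetP => [B _ cB|/(_ A)//]; apply: code_inj cA cB.
have fin : finite_set (boundary_arcs G Theta).
  exact: sub_finite_set sub (finite_fset F).
split=> //.
apply: (@leq_trans #|` F|%fset).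
  apply: fsubset_leq_card; apply/fsubsetP => A.
  by rewrite in_fset_set// inE => /sub.
rewrite size_seq_fset (leq_trans (size_undup _))// size_map -cardE.
by rewrite !card_prod !card_ord cardfE.
Qed.

End Counting.

Theorem theorem1 (R : realType) :
  exists K : R, forall (n : nat) (G : {fset R * R}) (Theta : R),
    #|` G|%fset = n -> 0 < Theta -> Theta < pi ->
    [/\ frontier (theta_region G Theta)
          `<=` \bigcup_(A in boundary_arcs G Theta) A,
        finite_set (boundary_arcs G Theta)
      & (#|` fset_set (boundary_arcs G Theta)|%fset)%:R <= K * (n%:R / Theta)].
Proof.
(* Three kinds of charge, times at most [2 * pi / Theta + 1] windows; the additional window costs at
   most [pi / Theta] because [Theta < pi]. This gives [3 * (2 * pi + pi)]. *)
exists (9 * pi) => n G Theta nE T0 Tpi.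
have hT : 0 < Theta < pi by rewrite T0.
have [fin card] := boundary_arcs_card G hT.
split => //; first exact: frontier_covered.
have pi0 := pi_gt0 R.
apply: (@le_trans _ _ (3 * n * (Num.truncn (2 * pi / Theta)).+1)%:R).
  by rewrite ler_nat -nE.
have x0 : 0 <= 2 * pi / Theta by rewrite divr_ge0// ltW//; lra.
have [h _] := andP (Num.Theory.truncn_itv x0).
have h1 : 1 <= pi / Theta by rewrite ler_pdivlMr// mul1r ltW.
have -> : 9 * pi * (n%:R / Theta) = 3 * n%:R * (2 * pi / Theta + pi / Theta).
  by ring.
rewrite !natrM -natr1; apply: ler_wpM2l; first by rewrite mulr_ge0.
by lra.
Qed.
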